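(* Let $(X,d)$ be a metric space and let $\mathscr{U}$ be a uniformly bounded open cover of $X$. Then the Vietoris metric thickening $\mathcal{V}^m(\mathscr{U})$ and the Vietoris complex $\mathcal{V}(\mathscr{U})$ have isomorphic homology groups, i.e. $H_j(\mathcal{V}^m(\mathscr{U}))\cong H_j(\mathcal{V}(\mathscr{U}))$ for every integer $j\ge 0$.
   Context: A cover $\mathscr{U}$ of a metric space is uniformly bounded if there is a finite constant $D$ such that every element of $\mathscr{U}$ has diameter at most $D$. The Vietoris complex $\mathcal{V}(\mathscr{U})$ is the simplicial complex whose vertex set is $X$ and whose simplices are the nonempty finite subsets of $X$ contained in some element of $\mathscr{U}$; its geometric realization carries the usual weak (simplicial complex) topology. The Vietoris metric thickening $\mathcal{V}^m(\mathscr{U})$ is the set of all finitely supported probability measures $\mu=\sum_{i=0}^n\lambda_i\delta_{x_i}$ on $X$ (with $\lambda_i>0$, $\sum_i\lambda_i=1$, $x_i\in X$ distinct, and $\delta_x$ the Dirac mass at $x$) whose support $\{x_0,\dots,x_n\}$ is contained in some element of $\mathscr{U}$. It is topologized by the $1$-Wasserstein metric: for $\mu=\sum_i\lambda_i\delta_{x_i}$ and $\nu=\sum_j\lambda'_j\delta_{y_j}$, $$d_W(\mu,\nu)=\inf\Big\{\sum_{i,j}\pi_{i,j}\,d(x_i,y_j)\ :\ \pi_{i,j}\ge 0,\ \sum_j\pi_{i,j}=\lambda_i,\ \sum_i\pi_{i,j}=\lambda'_j\Big\}.$$ It has the same underlying set as (the geometric realization of) $\mathcal{V}(\mathscr{U})$,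 but a coarser topology in general. Homology is singular homology with coefficients in $\mathbb{Z}$. *)

(* Defs.v *)
From HB Require Import structures.
From mathcomp Require Import all_boot all_order all_algebra finmap.
From mathcomp Require Import freeg.
From mathcomp Require Import all_classical all_reals all_analysis.
Import Order.TTheory GRing.Theory Num.Theory.
Import numFieldNormedType.Exports.

Set Implicit Arguments.
Unset Strict Implicit.
Unset Printing Implicit Defensive.

Local Open Scope classical_set_scope.
Local Open Scope ring_scope.

(* ** Singular homology with integer coefficients *)

Section SingularHomology.
Variable R : realType.

Definition stdsimplex (n : nat) : set 'rV[R]_n.+1 :=
  [set t | (forall i, 0 <= t 0 i) /\ \sum_i t 0 i = 1].

Arguments stdsimplex n : clear implicits.

(* The affine inclusion of the face opposite to the vertex [i]: a zero is
   inserted at position [i]. *)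
Definition face_row (n : nat) (i : 'I_n.+2) (t : 'rV[R]_n.+1) : 'rV[R]_n.+2 :=
  \row_j oapp (t 0) 0 (unlift i j).

Lemma face_row_simplex n (i : 'I_n.+2) (t : stdsimplex n) :
  face_row i (val t) \in stdsimplex n.+1.
Proof.
case: t => t /=; rewrite !inE => -[t0 t1]; split.
  by move=> j; rewrite mxE; case: unlift => //=.
rewrite (bigD1_ord i)//= mxE unlift_none/= add0r -t1.
by apply: eq_bigr => j _; rewrite mxE liftK.
Qed.

Definition face_map n (i : 'I_n.+2) (t : stdsimplex n) : stdsimplex n.+1 :=
  exist (fun x => x \in stdsimplex n.+1) _ (face_row_simplex i t).

Lemma face_map_continuous n (i : 'I_n.+2) : continuous (@face_map n i).
Proof.
suff c : continuous (set_val \o @face_map n i).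
  exact: (@continuous_comp_initial _ _ _ (@set_val _ (stdsimplex n.+1)) _ c).
move=> t A /= [P PM sPA].
have tF : Filter (nbhs t) by exact: nbhs_filter.
have H : \forall s \near t, forall a b, P a b (set_val (face_map i s) a b).
  apply: (@filter_forall _ _ _ _ tF) => a.
  apply: (@filter_forall _ _ _ _ tF) => b.
  have := PM a b; rewrite mxE => Pab.
  suff h : nbhs t [set s : stdsimplex n |
      P a b (oapp (val s 0) 0 (unlift i b))].
    by apply: (@filterS _ _ tF _ _ _ h) => s /=; rewrite mxE.
  move: Pab; case: unliftP => [c _|_] /= Pab.
    have ct : continuous (fun s : stdsimplex n => val s 0 c).
      move=> s; apply: (@continuous_comp _ _ _
        (val : stdsimplex n -> 'rV[R]_n.+1) (fun M : 'rV[R]_n.+1 => M 0 c)).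
        exact: initial_continuous.
      exact: coord_continuous.
    exact: ct Pab.
  apply: (@filterS _ _ tF setT); last exact: filterT.
  by move=> s _; exact: nbhs_singleton Pab.
by apply: (@filterS _ _ tF _ _ _ H) => s Qs; apply: sPA => a b; exact: Qs.
Qed.

HB.instance Definition _ n (i : 'I_n.+2) :=
  @isContinuous.Build (stdsimplex n) (stdsimplex n.+1) (@face_map n i)
    (@face_map_continuous n i).

Variable T : topologicalType.

Definition singular_simplex n := continuousType (stdsimplex n) T.

HB.instance Definition _ n := Choice.on (singular_simplex n).

Definition singular_face n (i : 'I_n.+2) (s : singular_simplex n.+1) :
  singular_simplex n := s \o face_map i.

Definition singular_chain n := {freeg (singular_simplex n) / int}.

HB.instance Definition _ n := GRing.Lmodule.on (singular_chain n).

Definition singular_boundary n : singular_chain n.+1 -> singular_chain n :=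
  fglift (fun s : singular_simplex n.+1 =>
    \sum_(i < n.+2) (-1) ^+ i *: (<< singular_face i s >> : singular_chain n)).

Lemma singular_boundary_is_additive n : additive (@singular_boundary n).
Proof. exact: lift_is_additive. Qed.

HB.instance Definition _ n := GRing.isAdditive.Build
  (singular_chain n.+1) (singular_chain n) (@singular_boundary n)
  (@singular_boundary_is_additive n).

(* In degree 0 every chain is a cycle. *)
Definition singular_cycles (n : nat) : {pred singular_chain n} :=
  match n with
  | 0 => fun=> true
  | m.+1 => fun c => singular_boundary c == 0
  end.

Lemma singular_cycles_zmod_closed n : zmod_closed (@singular_cycles n).
Proof.
case: n => [|n]; first by split.
split=> [|x y]; first by rewrite unfold_in/= raddf0.
rewrite !unfold_in/= => /eqP bx /eqP y0; rewrite raddfB/= bx y0.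
by rewrite subr0.
Qed.

HB.instance Definition _ n :=
  GRing.isZmodClosed.Build (singular_chain n) (@singular_cycles n)
    (@singular_cycles_zmod_closed n).

Record singular_cycle n := SingularCycle {
  cycle_val :> singular_chain n ;
  _ : cycle_val \in @singular_cycles n }.

HB.instance Definition _ n := [isSub for @cycle_val n].
HB.instance Definition _ n := [Choice of singular_cycle n by <:].
HB.instance Definition _ n :=
  [SubChoice_isSubZmodule of singular_cycle n by <:].

Definition singular_boundaries (n : nat) : {pred singular_cycle n} :=
  [pred z : singular_cycle n |
    `[< exists c : singular_chain n.+1, singular_boundary c = val z >]].

Lemma singular_boundaries_zmod_closed n : zmod_closed (@singular_boundaries n).
Proof.
split=> [|x y]; rewrite !unfold_in/=.
  by apply/asboolP; exists 0; rewrite !raddf0.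
move=> /asboolP[c cx] /asboolP[d dy]; apply/asboolP; exists (c - d).
rewrite raddfB/= cx dy; symmetry.
exact: (raddfB (val : singular_cycle n -> singular_chain n)).
Qed.

HB.instance Definition _ n :=
  GRing.isZmodClosed.Build (singular_cycle n) (@singular_boundaries n)
    (@singular_boundaries_zmod_closed n).

(* The quotient of the group of [n]-cycles by the subgroup of those which are
   boundaries of chains of degree [n.+1]. *)
Definition homology (n : nat) : zmodType := {ideal_quot @singular_boundaries n}.
End SingularHomology.

(* ** Finitely supported probability measures *)

(* The measure [\sum_i l_i \delta_(x_i)] is represented by its weights, i.e. the
   finitely supported function sending [x_i] to [l_i]; its support is
   [finsupp p]. *)
Definition fin_prob (R : realType) (X : choiceType) :
    set {fsfun X -> R with 0} :=
  [set p : {fsfun X -> R with 0} | (forall x, 0 <= p x) /\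
     \sum_(x <- finsupp p) p x = 1].

(* ** Geometric realization of a simplicial complex *)

Section Realization.
Variables (R : realType) (V : choiceType) (K : set {fset V}).

(* Points are given by their barycentric coordinates. *)
Definition realization : Type :=
  [set p : {fsfun V -> R with 0} | fin_prob p /\ K (finsupp p)].

HB.instance Definition _ := Choice.on realization.

Definition barycentric (s : {fset V}) (p : realization) : {ptws s -> R} :=
  fun v => val p (val v).

Arguments barycentric s p : clear implicits.

(* [W] is open iff its trace on each closed simplex |s| is open, where |s|
   carries the topology induced from R^s by the barycentric coordinates. *)
Definition weak_open : set_system realization :=
  [set W | forall s, K s -> exists2 O : set {ptws s -> R}, open O &
     forall p : realization, (finsupp (val p) `<=` s)%fset ->
       W p <-> O (barycentric s p)].

Lemma weak_openT : weak_open setT.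
Proof. by move=> s _; exists setT; first exact: openT. Qed.

Lemma weak_openI : setI_closed weak_open.
Proof.
move=> A B oA oB s Ks; have [P1 o1 h1] := oA s Ks; have [P2 o2 h2] := oB s Ks.
exists (P1 `&` P2); first exact: openI.
by move=> p ps; split=> -[? ?]; split; (apply/(h1 p ps) || apply/(h2 p ps)).
Qed.

Lemma weak_open_bigU (I : Type) (f : I -> set realization) :
  (forall i, weak_open (f i)) -> weak_open (\bigcup_i f i).
Proof.
move=> of_ s Ks.
have /choice[P hP] : forall i, exists O : set {ptws s -> R}, open O /\
    forall p : realization, (finsupp (val p) `<=` s)%fset ->
       f i p <-> O (barycentric s p).
  by move=> i; have [P oP h] := of_ i s Ks; exists P.
exists (\bigcup_i P i); first by apply: bigcup_open => i _; have [] := hP i.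
by move=> p ps; split=> -[i _ fip]; exists i => //; apply/(hP i).2.
Qed.

HB.instance Definition _ := isOpenTopological.Build realization
  weak_openT weak_openI weak_open_bigU.

End Realization.

(* ** The 1-Wasserstein distance *)

Section Wasserstein.
Variables (R : realType) (X : metricType R).
Implicit Types (p q r : {fsfun X -> R with 0}) (m : X -> X -> R).

(* The values of [m] outside [finsupp p] x [finsupp q] play no role. *)
Definition coupling p q : set (X -> X -> R) :=
  [set m | [/\ {in finsupp p & finsupp q, forall x y, 0 <= m x y},
    {in finsupp p, forall x, \sum_(y <- finsupp q) m x y = p x} &
    {in finsupp q, forall y, \sum_(x <- finsupp p) m x y = q y}]].

Definition transport_cost p q m : R :=
  \sum_(x <- finsupp p) \sum_(y <- finsupp q) m x y * mdist x y.

Definition wasserstein p q : R := inf (transport_cost p q @` coupling p q).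

Lemma transport_cost_ge0 p q m : coupling p q m -> 0 <= transport_cost p q m.
Proof.
case=> m0 _ _; rewrite /transport_cost big_seq; apply: sumr_ge0 => x xp.
by rewrite big_seq; apply: sumr_ge0 => y yq; rewrite mulr_ge0 ?m0 ?mdist_ge0.
Qed.

Lemma wasserstein_le p q m :
  coupling p q m -> wasserstein p q <= transport_cost p q m.
Proof.
move=> cm; apply: ge_inf; last by exists m.
by exists 0 => _ [m' cm' <-]; exact: transport_cost_ge0.
Qed.

Lemma coupling_prod p q : fin_prob p -> fin_prob q ->
  coupling p q (fun x y => p x * q y).
Proof.
move=> [p0 p1] [q0 q1]; split=> [x y _ _|x _|y _]; first by rewrite mulr_ge0.
- by rewrite -big_distrr/= q1 mulr1.
- by rewrite -big_distrl/= p1 mul1r.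
Qed.

Lemma le_wasserstein p q (c : R) : fin_prob p -> fin_prob q ->
  (forall m, coupling p q m -> c <= transport_cost p q m) ->
  c <= wasserstein p q.
Proof.
move=> pp pq h; apply: lb_le_inf => [|_ [m cm <-]]; last exact: h.
exists (transport_cost p q (fun x y => p x * q y)).
by exists (fun x y => p x * q y) => //; exact: coupling_prod.
Qed.

Lemma wasserstein_ge0 p q : fin_prob p -> fin_prob q -> 0 <= wasserstein p q.
Proof.
by move=> pp pq; apply: le_wasserstein => // m; exact: transport_cost_ge0.
Qed.

Lemma wassersteinxx p : fin_prob p -> wasserstein p p = 0.
Proof.
move=> pp; apply/eqP; rewrite eq_le wasserstein_ge0// andbT.
pose m x y := if x == y then p x else 0.
have <- : transport_cost p p m = 0.
  apply: big1 => x _; apply: big1 => y _; rewrite /m; case: eqP => [->|_].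
    by rewrite mdistxx mulr0.
  by rewrite mul0r.
apply: wasserstein_le; split=> [x y _ _|x xp|y yp]; rewrite /m.
- by case: ifP => // _; apply: pp.1.
- rewrite (big_fsetD1 x)//= eqxx big_seq big1 ?addr0// => y.
  by rewrite !inE eq_sym => /andP[/negbTE ->].
- rewrite (big_fsetD1 y)//= eqxx big_seq big1 ?addr0// => x.
  by rewrite !inE => /andP[/negbTE ->].
Qed.

Lemma wasserstein_sym_le p q : fin_prob p -> fin_prob q ->
  wasserstein p q <= wasserstein q p.
Proof.
move=> pp pq; apply: le_wasserstein => // m [m0 m1 m2].
have -> : transport_cost q p m = transport_cost p q (fun x y => m y x).
  rewrite /transport_cost exchange_big; apply: eq_bigr => x _ /=.
  by apply: eq_bigr => y _; rewrite metric_sym.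
by apply: wasserstein_le; split=> // x y xp yq; exact: m0.
Qed.

Lemma wasserstein_sym p q : fin_prob p -> fin_prob q ->
  wasserstein p q = wasserstein q p.
Proof. by move=> pp pq; apply/eqP; rewrite eq_le !wasserstein_sym_le. Qed.

Lemma wasserstein_triangle q p r : fin_prob p -> fin_prob q -> fin_prob r ->
  wasserstein p r <= wasserstein p q + wasserstein q r.
Proof.
move=> pp pq pr.
suff h m1 m2 : coupling p q m1 -> coupling q r m2 ->
    wasserstein p r <= transport_cost p q m1 + transport_cost q r m2.
  rewrite -lerBlDl; apply: le_wasserstein => // m2 c2; rewrite lerBlDl.
  rewrite -lerBlDr; apply: le_wasserstein => // m1 c1; rewrite lerBlDr.
  exact: h.
move=> [a0 a1 a2] [b0 b1 b2].
have q0 y : y \in finsupp q -> q y != 0 by rewrite mem_finsupp.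
pose m x z := \sum_(y <- finsupp q) m1 x y * m2 y z / q y.
have cm : coupling p r m.
  split=> [x z xp zr|x xp|z zr]; rewrite /m.
  - rewrite big_seq sumr_ge0// => y yq.
    by rewrite divr_ge0 ?mulr_ge0 ?a0 ?b0 ?pq.1.
  - rewrite exchange_big/= -(a1 _ xp) big_seq [RHS]big_seq.
    apply: eq_bigr => y yq; rewrite -big_distrl/= -big_distrr/= b1//.
    by rewrite mulfK ?q0.
  - rewrite exchange_big/= -(b2 _ zr) big_seq [RHS]big_seq.
    apply: eq_bigr => y yq; rewrite -big_distrl/= -big_distrl/= a2//.
    by rewrite mulrAC mulfV ?mul1r ?q0.
apply: (le_trans (wasserstein_le cm)).
pose t x y z := m1 x y * m2 y z / q y.
have -> : transport_cost p q m1 = \sum_(x <- finsupp p) \sum_(z <- finsupp r)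
    \sum_(y <- finsupp q) t x y z * mdist x y.
  apply: eq_bigr => x _; rewrite exchange_big/= big_seq [RHS]big_seq.
  apply: eq_bigr => y yq.
  rewrite -big_distrl/= /t -big_distrl/= -big_distrr/= b1//.
  by rewrite mulfK ?q0.
have -> : transport_cost q r m2 = \sum_(x <- finsupp p) \sum_(z <- finsupp r)
    \sum_(y <- finsupp q) t x y z * mdist y z.
  rewrite /transport_cost exchange_big [RHS]exchange_big.
  apply: eq_bigr => z _ /=.
  rewrite exchange_big/= big_seq [RHS]big_seq; apply: eq_bigr => y yq.
  rewrite -big_distrl/= /t -big_distrl/= -big_distrl/= a2//.
  by rewrite [q y * _]mulrC mulfK ?q0.
rewrite -big_split/= /transport_cost big_seq [leRHS]big_seq.
apply: ler_sum => x xp; rewrite -big_split/= big_seq [leRHS]big_seq.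
apply: ler_sum => z zr; rewrite -big_split/= /m big_distrl/=.
rewrite big_seq [leRHS]big_seq; apply: ler_sum => y yq.
rewrite -mulrDr ler_wpM2l ?metric_triangle//.
by rewrite divr_ge0 ?mulr_ge0 ?a0 ?b0 ?pq.1.
Qed.

Lemma wasserstein0_le p q x : fin_prob p -> fin_prob q ->
  wasserstein p q = 0 -> p x <= q x.
Proof.
move=> pp pq w0; case: (finsuppP p x) => [_|xp]; first by case: pq.
have [e e0 he] : exists2 e : R, 0 < e &
    {in (finsupp q : seq X), forall y, y != x -> e <= mdist x y}.
  elim: (finsupp q : seq X) => [|y s [e e0 he]]; first by exists 1.
  have [->|yx] := eqVneq y x.
    exists e => // z; rewrite inE => /orP[/eqP->|zs]; last exact: he.
    by rewrite eqxx.
  exists (Num.min e (mdist x y)).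
    by rewrite lt_min e0 mdist_gt0 eq_sym.
  move=> z; rewrite inE ge_min => /orP[/eqP-> _|zs zx].
    by rewrite lexx orbT.
  by rewrite he.
rewrite -subr_le0 -(pmulr_rle0 _ e0) -[leRHS]w0.
apply: le_wasserstein => // m [m0 m1 m2].
have -> : e * (p x - q x) =
    \sum_(y <- finsupp q) e * (m x y - (y == x)%:R * q x).
  rewrite -big_distrr/= sumrB m1//; congr (_ * (_ - _)).
  case: (finsuppP q x) => [xq|xq].
    by rewrite big1 ?mulr0// => y _; rewrite mulr0.
  rewrite (big_fsetD1 x)//= eqxx mul1r big_seq big1 ?addr0// => y.
  by rewrite !inE => /andP[/negbTE ->]; rewrite mul0r.
apply: (@le_trans _ _ (\sum_(y <- finsupp q) m x y * mdist x y)).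
  rewrite big_seq [leRHS]big_seq; apply: ler_sum => y yq.
  have [y_x|yx] := eqVneq y x; last first.
    by rewrite mul0r subr0 mulrC ler_wpM2l ?m0 ?he.
  rewrite y_x in yq *.
  rewrite mdistxx mulr0 mul1r pmulr_rle0// subr_le0 -(m2 x)//.
  rewrite (big_fsetD1 x)//= lerDl big_seq sumr_ge0// => z.
  by rewrite !inE => /andP[_ zp]; rewrite m0.
rewrite /transport_cost (big_fsetD1 x xp)/= lerDl big_seq sumr_ge0// => x'.
rewrite !inE => /andP[_ x'p]; rewrite big_seq sumr_ge0// => y yq.
by rewrite mulr_ge0 ?m0 ?mdist_ge0.
Qed.

Lemma wasserstein_positivity p q : fin_prob p -> fin_prob q ->
  wasserstein p q = 0 -> p = q.
Proof.
move=> pp pq w0; apply/fsfunP => x; apply/eqP; rewrite eq_le.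
by rewrite !wasserstein0_le// wasserstein_sym.
Qed.

End Wasserstein.

Section Vietoris.
Variables (R : realType) (X : metricType R) (U : set (set X)).

(* Every member of [U] has diameter at most [D]. *)
Definition uniformly_bounded : Prop :=
  exists D : R, forall A, U A -> forall x y, A x -> A y -> mdist x y <= D.

Definition open_cover : Prop := U `<=` open /\ \bigcup_(A in U) A = setT.

Definition vietoris_complex : set {fset X} :=
  [set s | s != fset0 /\ exists2 A, U A & [set` s] `<=` A].

Definition vietoris_thickening : Type :=
  [set p : {fsfun X -> R with 0} | fin_prob p /\
     exists2 A, U A & [set` finsupp p] `<=` A].

HB.instance Definition _ := Choice.on vietoris_thickening.

Implicit Types p q r : vietoris_thickening.

Let pr p : fin_prob (val p).
Proof. by case: p => p /= /set_mem[]. Qed.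

Let dist p q := wasserstein (val p) (val q).

Let distxx p : dist p p = 0. Proof. exact: wassersteinxx. Qed.
Let dist_pos p q : dist p q = 0 -> p = q.
Proof. by move=> h; apply/val_inj/wasserstein_positivity. Qed.
Let dist_sym p q : dist p q = dist q p. Proof. exact: wasserstein_sym. Qed.
Let dist_triangle q p r : dist p r <= dist p q + dist q r.
Proof. exact: wasserstein_triangle. Qed.

HB.instance Definition _ :=
  @isMetric.Build R vietoris_thickening dist distxx dist_pos dist_sym
    dist_triangle.

End Vietoris.

(* Main.v *)
Require Import Defs.
From mathcomp Require Import freeg.
From HB Require Import structures.
From mathcomp Require Import all_boot all_order all_algebra finmap.
From mathcomp Require Import zify ring lra.
From mathcomp Require Import all_classical all_reals all_analysis.

(* The Vietoris complex maps continuously and bijectively onto the thickening,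
   and a singular simplex of the thickening is continuous for the topology of the
   complex iff its values are supported in one finite set. So it suffices to show
   that the singular chains of the thickening modulo the finitely supported ones
   are acyclic.

   Fix a degree n and cover the thickening by the open sets O_A of the measures
   mu with mu(A) > 1 - 1/(n+1), for A in U; by barycentric subdivision, chains may
   be assumed to be small with respect to this cover. If mu lies in at most n
   of the O_A, then mu(G) > 0 for the intersection G of the A's. Let g be a
   Lipschitz function which is positive exactly on G: moving mu linearly to
   g mu / (integral of g), and then linearly to a Dirac mass in G, contracts the
   intersection of the O_A inside itself, and adds at most one point to the
   supports; the cone operator of this contraction shows that the intersection
   is acyclic modulo finitely supported chains. A Mayer-Vietoris induction on
   the degree, in which only intersections of at most n sets occur,
   concludes. *)

Import Order.TTheory GRing.Theory Num.Theory.
Import numFieldNormedType.Exports.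

Set Implicit Arguments.
Unset Strict Implicit.
Unset Printing Implicit Defensive.

Local Open Scope classical_set_scope.
Local Open Scope ring_scope.

(** * Chains with prescribed supports *)

(** Where the choices come from. If k sets each carry more than 1 - 1/(n+1) of the mass of a
    measure, their intersection carries more than 1 - k/(n+1); this says something only for
    boundedly many sets, so no single threshold serves all degrees. Each Mayer-Vietoris step trades
    one degree for one more set, and in degree 0 every simplex is finitely supported; hence the link
    between the degree and the threshold. Restricting a measure to G by an indicator would not be
    continuous for the Wasserstein metric, hence the Lipschitz density. Uniform boundedness enters
    through the convergence criterion [cvg_thickening]: mass that escapes control travels only a
    bounded distance, so it is enough to bound from below the masses of small balls around the
    support of the limit. The two topologies agree over a finite set S of points because these are
    separated: Wasserstein convergence then controls every barycentric coordinate. *)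

Section SupportedChains.
Variable K : choiceType.
Implicit Types (P Q : set K) (c : {freeg K / int}).

Definition supported P c : Prop := forall x, x \in dom c -> P x.

Lemma supported0 P : supported P 0.
Proof. by move=> x; rewrite dom0. Qed.

Lemma supportedD P c1 c2 :
  supported P c1 -> supported P c2 -> supported P (c1 + c2).
Proof.
by move=> h1 h2 x /domD_subset; rewrite mem_cat => /orP[/h1|/h2].
Qed.

Lemma supportedN P c : supported P c -> supported P (- c).
Proof. by move=> h x; rewrite domN => /h. Qed.

Lemma supportedB P c1 c2 :
  supported P c1 -> supported P c2 -> supported P (c1 - c2).
Proof. by move=> h1 /supportedN; exact: supportedD. Qed.

Lemma supportedZ P (k : int) c : supported P c -> supported P (k *: c).
Proof. by move=> h x /domZ_subset/h. Qed.

Lemma supported_sum P (I : Type) (r : seq I) (q : pred I)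
    (f : I -> {freeg K / int}) :
  (forall i, q i -> supported P (f i)) -> supported P (\sum_(i <- r | q i) f i).
Proof.
move=> h; apply: (big_ind (supported P)); [exact: supported0| |exact: h].
by move=> *; exact: supportedD.
Qed.

Lemma supportedU P k x : P x -> supported P << k *g x >>.
Proof.
move=> Px; have [->|k0] := eqVneq k 0; first by rewrite freegU0; exact: supported0.
by move=> y; rewrite domU// inE => /eqP->.
Qed.

Lemma sub_supported P Q c : P `<=` Q -> supported P c -> supported Q c.
Proof. by move=> PQ h x /h/PQ. Qed.

Lemma supportedI P Q c : supported P c -> supported Q c -> supported (P `&` Q) c.
Proof. by move=> hP hQ x xc; split; [exact: hP|exact: hQ]. Qed.

Lemma supported_set0 c : supported set0 c -> c = 0.
Proof.
move=> h; apply/eqP; rewrite -dom_eq0 -size_eq0 -leqn0 leqNgt -has_predT; apply/negP.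
by case/hasP => x /h.
Qed.

Lemma supported_ind P (Q : {freeg K / int} -> Prop) : Q 0 ->
  (forall k x c, P x -> supported P c -> Q c -> Q (<< k *g x >> + c)) ->
  forall c, supported P c -> Q c.
Proof.
move=> Q0 QS c hc; rewrite -[c]freeg_sumE.
suff: Q (\sum_(z <- dom c) << (coeff z c) *g z >>) /\
    supported P (\sum_(z <- dom c) << (coeff z c) *g z >>) by case.
rewrite big_seq; apply: (big_rec (fun d => Q d /\ supported P d)).
  by split=> //; exact: supported0.
move=> x d xc [Qd Pd]; split; first by apply: QS => //; exact: hc.
by apply: supportedD => //; apply: supportedU; exact: hc.
Qed.

Lemma supported_split P Q c : supported (P `|` Q) c ->
  exists c1 c2, [/\ c = c1 + c2, supported P c1 & supported Q c2].
Proof.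
move: c; apply: supported_ind => [|k x c PQx _ [c1 [c2 [-> P1 Q2]]]].
  by exists 0, 0; split; [rewrite addr0|exact: supported0..].
case: PQx => [Px|Qx].
  exists (<< k *g x >> + c1), c2; split=> //; first by rewrite addrA.
  by apply: supportedD => //; exact: supportedU.
exists c1, (<< k *g x >> + c2); split=> //; first by rewrite addrCA.
by apply: supportedD => //; exact: supportedU.
Qed.

Lemma eq_supported (V : zmodType) (f g : {additive {freeg K / int} -> V}) P c :
  (forall x, P x -> f << x >> = g << x >>) -> supported P c -> f c = g c.
Proof.
move=> fg; move: c; apply: supported_ind => [|k x c Px _ fgc].
  by rewrite !raddf0.
have -> : << k *g x >> = << x >> *~ k :> {freeg K / int}.
  by rewrite freegU_mulz intz.
by rewrite !raddfD !raddfMz/= fg// fgc.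
Qed.

Lemma eq_freeg (V : zmodType) (f g : {additive {freeg K / int} -> V}) :
  (forall x, f << x >> = g << x >>) -> f =1 g.
Proof. by move=> fg c; apply: (@eq_supported _ f g setT) => // x _. Qed.

End SupportedChains.

Lemma additiveZint (U V : lmodType int) (f : {additive U -> V}) (k : int) u :
  f (k *: u) = k *: f u.
Proof. by rewrite -[k]intz !scaler_int raddfMz. Qed.

Lemma fgliftU1 (K : choiceType) (M : lmodType int) (f : K -> M) x : fglift f << x >> = f x.
Proof. by rewrite liftU scale1r. Qed.

HB.instance Definition _ (K : choiceType) (M : lmodType int) (f : K -> M) :=
  GRing.isAdditive.Build {freeg K / int} M (fglift f) (lift_is_additive f).

Lemma fglift_supported (K L : choiceType) (f : K -> {freeg L / int})
    (P : set K) (Q : set L) c : (forall x, P x -> supported Q (f x)) ->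
  supported P c -> supported Q (fglift f c).
Proof.
move=> fPQ; move: c; apply: supported_ind => [|k x c Px _ Qc].
  by rewrite raddf0; exact: supported0.
rewrite raddfD/= liftU; apply: supportedD => //.
by apply: supportedZ; exact: fPQ.
Qed.

Definition chain_map (K L : choiceType) (f : K -> L) :
  {freeg K / int} -> {freeg L / int} := fglift (fun x => << f x >>).

HB.instance Definition _ (K L : choiceType) (f : K -> L) :=
  GRing.Additive.copy (chain_map f) (fglift (fun x => << f x >>)).

Lemma chain_mapU (K L : choiceType) (f : K -> L) x :
  chain_map f << x >> = << f x >>.
Proof. exact: fgliftU1. Qed.

Lemma chain_map_comp (K L M : choiceType) (g : L -> M) (f : K -> L) c :
  chain_map g (chain_map f c) = chain_map (g \o f) c.
Proof.
move: c; apply: (@eq_freeg _ _ (chain_map g \o chain_map f) (chain_map (g \o f))).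
by move=> x /=; rewrite !chain_mapU.
Qed.

Lemma chain_map_supported (K L : choiceType) (f : K -> L) (P : set K)
    (Q : set L) c : (forall x, P x -> Q (f x)) ->
  supported P c -> supported Q (chain_map f c).
Proof.
by move=> fPQ; apply: fglift_supported => x /fPQ; exact: supportedU.
Qed.

(** * Boundary operators and cones for an abstract family of face maps *)

Section Boundary.
Variables (X : nat -> choiceType) (d : forall n, 'I_n.+2 -> X n.+1 -> X n).

(** Kept abstract to serve both singular simplices and affine ones; for the former it is convertible
    with [singular_boundary]. *)
Definition bd n : {freeg (X n.+1) / int} -> {freeg (X n) / int} :=
  fglift (fun x => \sum_(i < n.+2) (-1) ^+ i *: (<< d i x >> : {freeg (X n) / int})).

HB.instance Definition _ n := GRing.Additive.copy (@bd n)
  (fglift (fun x => \sum_(i < n.+2) (-1) ^+ i *: (<< d i x >> : {freeg (X n) / int}))).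

Lemma bdU n (x : X n.+1) :
  bd << x >> = \sum_(i < n.+2) (-1) ^+ i *: (<< d i x >> : {freeg (X n) / int}).
Proof. exact: fgliftU1. Qed.

Lemma bd_supported n (P : set (X n.+1)) (Q : set (X n)) c :
  (forall x i, P x -> Q (d i x)) -> supported P c -> supported Q (bd c).
Proof.
move=> dPQ; apply: fglift_supported => x Px.
apply: supported_sum => i _.
apply: supportedZ.
apply: supportedU.
exact: dPQ.
Qed.

Hypothesis dd : forall n (i j : 'I_n.+2) (x : X n.+2), (i <= j)%N ->
  d i (d (lift ord0 j) x) = d j (d (widen_ord (leqnSn _) i) x).

Lemma bd_bd n (c : {freeg (X n.+2) / int}) : bd (bd c) = 0.
Proof.
move: c; apply: (@eq_freeg _ _ (@bd n \o @bd n.+1) \0) => x /=.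
rewrite bdU raddf_sum/=.
under eq_bigr => j _.
  rewrite additiveZint/= bdU scaler_sumr.
  under eq_bigr => i _ do rewrite scalerA -exprD.
  over.
rewrite exchange_big/=.
under eq_bigr => i _ do rewrite (bigID (fun j : 'I_n.+3 => (i < j)%N))/=.
rewrite big_split/= addrC; apply/eqP; rewrite addr_eq0; apply/eqP.
transitivity (\sum_(i < n.+2) \sum_(j < n.+2 | (j <= i)%N) (-1) ^+ (j + i) *:
    (<< d i (d (widen_ord (leqnSn _) j) x) >> : {freeg (X n) / int})).
  apply: eq_bigr => i _; rewrite big_mkcond big_ord_recr/= ltn_ord addr0.
  by rewrite [RHS]big_mkcond; apply: eq_bigr => j _; rewrite -leqNgt.
(* Shifting [j] by one turns [i < j] into [i <= j] and flips the sign; the simplicial identity [dd]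
   then matches the two halves. *)
rewrite -sumrN [RHS](eq_bigr (fun i : 'I_n.+2 =>
    \sum_(j < n.+2 | (i <= j)%N) (-1) ^+ (i + j) *:
    (<< d j (d (widen_ord (leqnSn _) i) x) >> : {freeg (X n) / int}))).
  rewrite (exchange_big_dep xpredT)//=.
move=> i _; rewrite big_mkcond big_ord_recl/= add0r -sumrN big_mkcond/=.
rewrite [RHS]big_mkcond; apply: eq_bigr => j _.
rewrite /bump/= add1n ltnS; case: ifPn => [ij|]; last by rewrite oppr0.
by rewrite dd// -scaleNr addSn exprS mulN1r opprK addnC.
Qed.

(** Face 0 of a cone is its base and the other faces are cones over the faces, with signs shifted by
    one. The cone identities are asked on [P] only, because the contraction gives a cone only on the
    simplices that meet [G]. Degree 0 is excluded: there the apex would appear as an extra term. *)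
Lemma bd_cone n (k : forall n, X n -> X n.+1) (P : set (X n.+1)) c :
  (forall x, P x -> d ord0 (k _ x) = x) ->
  (forall x i, P x -> d (lift ord0 i) (k _ x) = k _ (d i x)) ->
  supported P c ->
  bd (chain_map (@k n.+1) c) = c - chain_map (@k n) (bd c).
Proof.
move=> d0 d1.
apply: (@eq_supported _ _ (@bd n.+1 \o chain_map (@k n.+1))
  (idfun \- (chain_map (@k n) \o @bd n))) => x Px /=.
rewrite chain_mapU !bdU big_ord_recl expr0 scale1r d0//; congr (_ + _).
rewrite raddf_sum/= -sumrN; apply: eq_bigr => i _.
rewrite d1//= /bump/= add1n exprS mulN1r scaleNr; congr (- _).
by rewrite additiveZint/= chain_mapU.
Qed.

End Boundary.

Lemma bd_chain_map (X Y : nat -> choiceType)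
    (d : forall n, 'I_n.+2 -> X n.+1 -> X n)
    (e : forall n, 'I_n.+2 -> Y n.+1 -> Y n) (f : forall n, Y n -> X n) n c :
  (forall i y, d n i (f n.+1 y) = f n (e n i y)) ->
  bd d (chain_map (@f n.+1) c) = chain_map (@f n) (bd e c).
Proof.
move=> de; move: c; apply: (@eq_freeg _ _ (@bd _ d n \o chain_map (@f n.+1))
  (chain_map (@f n) \o @bd _ e n)) => y /=.
rewrite chain_mapU !bdU raddf_sum/=; apply: eq_bigr => i _.
by rewrite additiveZint/= chain_mapU de.
Qed.

(** * Relative Mayer-Vietoris induction *)

Section RelativeMayerVietoris.
Variables (X : nat -> choiceType) (d : forall n, 'I_n.+2 -> X n.+1 -> X n).
Hypothesis dd : forall n (i j : 'I_n.+2) (x : X n.+2), (i <= j)%N ->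
  d i (d (lift ord0 j) x) = d j (d (widen_ord (leqnSn _) i) x).
Variable F : forall n, set (X n).
Hypothesis F0 : forall x, @F 0 x.
Hypothesis Fd : forall n (i : 'I_n.+2) (x : X n.+1), F x -> F (d i x).

(* Cycles and boundaries modulo the chains supported in [F]. *)
Definition rel_cycle n : {freeg (X n) / int} -> Prop :=
  if n is m.+1 then fun c => supported (@F m) (bd d c) else fun=> True.

Definition rel_boundary n (P : set (X n.+1)) (c : {freeg (X n) / int}) :=
  exists2 e, supported P e & supported (@F n) (c - bd d e).

Lemma rel_cycleB n c1 c2 :
  @rel_cycle n c1 -> rel_cycle c2 -> rel_cycle (c1 - c2).
Proof. by case: n c1 c2 => //= n c1 c2 ? ?; rewrite raddfB; exact: supportedB. Qed.

Lemma rel_cycle_F n c : supported (@F n) c -> rel_cycle c.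
Proof. by case: n c => //= n c; apply: bd_supported => x i; exact: Fd. Qed.

Lemma rel_cycle_bd n (c : {freeg (X n.+1) / int}) : rel_cycle (bd d c).
Proof. by case: n c => //= n c; rewrite bd_bd//; exact: supported0. Qed.

Lemma rel_cycle_sub n c1 c2 :
  supported (@F n) (c1 - c2) -> rel_cycle c1 -> rel_cycle c2.
Proof.
move=> h h1; rewrite -(subKr c1 c2).
by apply: rel_cycleB => //; exact: rel_cycle_F.
Qed.

Lemma rel_boundaryD n (P : set (X n.+1)) c1 c2 :
  rel_boundary P c1 -> rel_boundary P c2 -> rel_boundary P (c1 + c2).
Proof.
move=> [e1 P1 F1] [e2 P2 F2]; exists (e1 + e2); first exact: supportedD.
by rewrite raddfD/= opprD addrACA; exact: supportedD.
Qed.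

Lemma rel_boundary_F n (P : set (X n.+1)) c :
  supported (@F n) c -> rel_boundary P c.
Proof. by exists 0; [exact: supported0|rewrite raddf0 subr0]. Qed.

Variables (I : eqType) (O : I -> forall n, set (X n)).
Hypothesis Od : forall i n (k : 'I_n.+2) (x : X n.+1), O i x -> O i (d k x).

Definition all_in (s : seq I) n : set (X n) :=
  [set x | forall i, i \in s -> O i x].

Definition some_in (L s : seq I) n : set (X n) :=
  [set x | F x \/ exists2 i, i \in L & all_in (i :: s) x].

Variable N : nat.
Hypothesis acyclic : forall i s n c, (size s < N)%N ->
  supported (@all_in (i :: s) n) c -> rel_cycle c ->
  rel_boundary (@all_in (i :: s) n.+1) c.

Lemma all_in_d s n (k : 'I_n.+2) (x : X n.+1) : all_in s x -> all_in s (d k x).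
Proof. by move=> h i /h; exact: Od. Qed.

Lemma some_in_d L s n (k : 'I_n.+2) (x : X n.+1) :
  some_in L s x -> some_in L s (d k x).
Proof.
by case=> [/Fd|[i iL /all_in_d h]]; [left|right; exists i].
Qed.

(* Induction on the degree, then on [L]: the boundary of the part of [c] lying
   in the first set of [L] is a relative cycle of smaller degree lying in the
   pairwise intersections with the other sets. *)
Lemma rel_boundary_some_in n L s c : (size s + n <= N)%N ->
  supported (@some_in L s n) c -> rel_cycle c ->
  rel_boundary (@some_in L s n.+1) c.
Proof.
elim: n L s c => [|n IHn] L s c sN.
  by move=> _ _; apply: rel_boundary_F => x _; exact: F0.
elim: L c => [|i L IHL] c Lc cc.
  by apply: rel_boundary_F => x /Lc[//|[]].
have /supported_split[c1 [c2 [c12 h1 h2]]] :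
    supported (@all_in (i :: s) n.+1 `|` @some_in L s n.+1) c.
  move=> x /Lc[Fx|[j]]; first by right; left.
  by rewrite inE => /orP[/eqP->|jL] h; [left|right; right; exists j].
have h12 : supported (@some_in L (i :: s) n) (bd d c1).
  have b1 : supported (@all_in (i :: s) n) (bd d c1).
    by apply: bd_supported h1 => x k; exact: all_in_d.
  have b2 : supported (@some_in L s n) (bd d c1).
    rewrite (_ : bd d c1 = bd d c - bd d c2); last first.
      by rewrite c12 raddfD/= addrK.
    apply: supportedB; first by move: cc => /=; apply: sub_supported => x; left.
    by apply: bd_supported h2 => x k; exact: some_in_d.
  move=> x xc; have := b1 x xc; have [Fx _|[j jL js] is_] := b2 x xc; first by left.
  right; exists j => // k; rewrite !inE => /or3P[/eqP->|/eqP->|ks].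
  - by apply: js; rewrite inE eqxx.
  - by apply: is_; rewrite inE eqxx.
  - by apply: is_; rewrite inE ks orbT.
(* The degree drops by one while [s] grows by one, so the bound [size s + n <= N] is preserved. *)
have [|e1 he1 Fe1] := IHn L (i :: s) (bd d c1) _ h12 (rel_cycle_bd c1).
  by rewrite /= addSnnS.
(* Modulo [F], the chain [e] has the same boundary as [c1] and lies in the first set as well as in
   the others. Hence [c = (c1 - e) + (c2 + e)] is a sum of two relative cycles: [acyclic] fills the
   first and the induction on [L] the second. *)
have [f [e [fe Ff he]]] : exists f e, [/\ e1 = f + e, supported (@F n.+1) f &
    supported (@all_in (i :: s) n.+1 `&` @some_in L s n.+1) e].
  apply: supported_split => x /he1[Fx|[j jL ji]]; [by left|right; split].
    by move=> k ks; apply: ji; rewrite inE ks orbT.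
  right; exists j => // k; rewrite inE => /orP[/eqP->|ks].
    by apply: ji; rewrite inE eqxx.
  by apply: ji; rewrite !inE ks !orbT.
have hc1e : rel_cycle (c1 - e).
  rewrite /= raddfB/=; have -> : e = e1 - f by rewrite fe addrC addKr.
  rewrite raddfB/= opprB addrCA; apply: supportedD => //.
  by apply: bd_supported Ff => x k; exact: Fd.
have sN1 : (size s < N)%N by apply: leq_trans sN; rewrite addnS ltnS leq_addr.
have hc1e_in : supported (@all_in (i :: s) n.+1) (c1 - e).
  by apply: supportedB => //; apply: sub_supported he => x [].
have [e2 he2 Fe2] := acyclic sN1 hc1e_in hc1e.
have c2e : c2 + e = c - (c1 - e) by 
  by rewrite c12 opprB [e - c1]addrC addrACA subrr add0r.
have hc2e_in : supported (@some_in L s n.+1) (c2 + e).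
  by apply: supportedD => //; apply: sub_supported he => x [].
have hc2e : @rel_cycle n.+1 (c2 + e) by rewrite c2e; exact: rel_cycleB.
have [e3 he3 Fe3] := IHL _ hc2e_in hc2e.
have -> : c = (c1 - e) + (c2 + e) by rewrite c2e addrC subrK.
apply: rel_boundaryD.
  exists e2 => //; apply: sub_supported he2 => x h; right.
  by exists i => //; rewrite inE eqxx.
exists e3 => //; apply: sub_supported he3 => x [Fx|[j jL js]]; first by left.
by right; exists j => //; rewrite inE jL orbT.
Qed.

End RelativeMayerVietoris.

(** * Barycentric subdivision *)

Section Subdivision.
Variables (X : nat -> choiceType) (d : forall n, 'I_n.+2 -> X n.+1 -> X n).
Hypothesis dd : forall n (i j : 'I_n.+2) (x : X n.+2), (i <= j)%N ->
  d i (d (lift ord0 j) x) = d j (d (widen_ord (leqnSn _) i) x).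
Variables (B : Type) (cone : B -> forall n, X n -> X n.+1).
Hypothesis d_cone0 : forall b n (x : X n), d ord0 (cone b x) = x.
Hypothesis d_coneS : forall b n (i : 'I_n.+2) (x : X n.+1),
  d (lift ord0 i) (cone b x) = cone b (d i x).
Variable bary : forall n, X n -> B.

(** Cones from barycenters exist for affine simplices, not for singular ones; subdivision is
    therefore built on the former and carried over by naturality. *)
Fixpoint sd n : {freeg (X n) / int} -> {freeg (X n) / int} :=
  if n is m.+1 then
    fglift (fun x : X m.+1 => chain_map (@cone (bary x) m) (sd (bd d << x >>)))
  else id.

Fixpoint sd_homotopy n : {freeg (X n) / int} -> {freeg (X n.+1) / int} :=
  if n is m.+1 then
    fglift (fun x : X m.+1 => chain_map (@cone (bary x) m.+1)
                         (<< x >> - sd_homotopy (bd d << x >>)))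
  else fun=> 0.

Lemma sd_additive n : additive (@sd n).
Proof. by case: n => [|n] x y //=; rewrite raddfB. Qed.

HB.instance Definition _ n := GRing.isAdditive.Build
  {freeg (X n) / int} {freeg (X n) / int} (@sd n) (@sd_additive n).

Lemma sd_homotopy_additive n : additive (@sd_homotopy n).
Proof. by case: n => [|n] x y //=; [rewrite subr0|rewrite raddfB]. Qed.

HB.instance Definition _ n := GRing.isAdditive.Build
  {freeg (X n) / int} {freeg (X n.+1) / int} (@sd_homotopy n)
  (@sd_homotopy_additive n).

#[global] Arguments sd : simpl never.
#[global] Arguments sd_homotopy : simpl never.

Lemma sdS n (x : X n.+1) :
  sd << x >> = chain_map (@cone (bary x) n) (sd (bd d << x >>)).
Proof. exact: fgliftU1. Qed.

Lemma sd_homotopyS n (x : X n.+1) :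
  sd_homotopy << x >> = chain_map (@cone (bary x) n.+1)
                         (<< x >> - sd_homotopy (bd d << x >>)).
Proof. exact: fgliftU1. Qed.

(** The chain homotopy between subdivision and the identity; in degree 0 there is no boundary, so
    one term is missing. *)
Definition bd_sd_homotopy_stmt n : {freeg (X n) / int} -> Prop :=
  if n is m.+1 then
    fun c => bd d (sd_homotopy c) + sd_homotopy (bd d c) = c - sd c
  else fun c => bd d (sd_homotopy c) = c - sd c.

Lemma bd_sd_homotopy n c : @bd_sd_homotopy_stmt n c.
Proof.
elim: n c => [|n IHn] c /=; first by rewrite raddf0 subrr.
move: c; apply: (@eq_freeg _ _
  ((@bd _ d n.+1 \o @sd_homotopy n.+1) \+ (@sd_homotopy n \o @bd _ d n))
  (idfun \- @sd n.+1)) => x.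
change (bd d (sd_homotopy << x >>) + sd_homotopy (bd d << x >>) =
  << x >> - sd << x >>).
rewrite sd_homotopyS (@bd_cone _ _ _ (@cone (bary x)) setT)//.
rewrite raddfB/= sdS.
(* The induction hypothesis for the boundary of [x], whose own boundary vanishes. *)
suff -> : bd d (sd_homotopy (bd d << x >>)) = bd d << x >> - sd (bd d << x >>).
  by rewrite subKr addrAC subrK.
case: n IHn x => [|n] IHn x; first exact: IHn.
by rewrite -IHn bd_bd// raddf0 addr0.
Qed.

End Subdivision.

Section SubdivisionNaturality.
Variables (X Y : nat -> choiceType).
Variables (d : forall n, 'I_n.+2 -> X n.+1 -> X n).
Variables (e : forall n, 'I_n.+2 -> Y n.+1 -> Y n).
Variables (B C : Type) (coneX : B -> forall n, X n -> X n.+1).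
Variables (coneY : C -> forall n, Y n -> Y n.+1).
Variables (baryX : forall n, X n -> B) (baryY : forall n, Y n -> C).
Variables (f : forall n, X n -> Y n) (g : B -> C).
Hypothesis ef : forall n (i : 'I_n.+2) (x : X n.+1), e i (f x) = f (d i x).
Hypothesis f_cone : forall b n (x : X n), f (coneX b x) = coneY (g b) (f x).
Hypothesis f_bary : forall n (x : X n), baryY (f x) = g (baryX x).

(** Applied to composition with a fixed affine map, which preserves faces, cones and barycenters:
    subdividing the identity simplex then determines all subdivisions. *)
Lemma sd_chain_map n c : sd e coneY baryY (chain_map (@f n) c) =
  chain_map (@f n) (sd d coneX baryX c).
Proof.
elim: n c => [//|n IHn] c.
move: c; apply: (@eq_freeg _ _
  (@sd _ e _ coneY baryY n.+1 \o chain_map (@f n.+1))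
  (chain_map (@f n.+1) \o @sd _ d _ coneX baryX n.+1)) => x /=.
rewrite chain_mapU !sdS -chain_mapU (bd_chain_map (d := e) (e := d))//.
rewrite IHn !chain_map_comp f_bary; congr chain_map.
by apply/funext => y /=; rewrite f_cone.
Qed.

Lemma sd_homotopy_chain_map n c :
  sd_homotopy e coneY baryY (chain_map (@f n) c) =
  chain_map (@f n.+1) (sd_homotopy d coneX baryX c).
Proof.
elim: n c => [|n IHn] c; first by change (0 = chain_map (@f 1) 0); rewrite raddf0.
move: c; apply: (@eq_freeg _ _
  (@sd_homotopy _ e _ coneY baryY n.+1 \o chain_map (@f n.+1))
  (chain_map (@f n.+2) \o @sd_homotopy _ d _ coneX baryX n.+1)) => x /=.
rewrite chain_mapU !sd_homotopyS -chain_mapU (bd_chain_map (d := e) (e := d))//.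
rewrite IHn -raddfB/= !chain_map_comp f_bary; congr chain_map.
by apply/funext => y /=; rewrite f_cone.
Qed.

End SubdivisionNaturality.

(** * Affine simplices of the standard simplex and the mesh of their subdivision *)

Section SimplexCoordinates.
Variable R : realType.

Lemma simplex_ge0 n (t : @stdsimplex R n) i : 0 <= val t 0 i.
Proof. by case: t => t /= /set_mem[]. Qed.

Lemma simplex_sum n (t : @stdsimplex R n) : \sum_i val t 0 i = 1.
Proof. by case: t => t /= /set_mem[]. Qed.

Lemma simplex_le1 n (t : @stdsimplex R n) i : val t 0 i <= 1.
Proof.
rewrite -(simplex_sum t) (bigD1 i)//= lerDl sumr_ge0// => j _.
exact: simplex_ge0.
Qed.

Lemma simplexP n (t u : @stdsimplex R n) :
  (forall i, val t 0 i = val u 0 i) -> t = u.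
Proof. by move=> tu; apply/val_inj/rowP. Qed.

Lemma cvg_sumr (I T : Type) (F : set_system T) (r : seq I) (f : I -> T -> R)
    (a : I -> R) : Filter F -> (forall i, f i x @[x --> F] --> a i) ->
  \sum_(i <- r) f i x @[x --> F] --> \sum_(i <- r) a i.
Proof. by move=> FF fa; apply: cvg_big => [|//]; exact: add_continuous. Qed.

Lemma coord_simplex_continuous n (i : 'I_n.+1) :
  continuous (fun t : @stdsimplex R n => val t 0 i).
Proof.
move=> t; apply: (@continuous_comp _ _ _
  (val : @stdsimplex R n -> 'rV[R]_n.+1) (fun M : 'rV[R]_n.+1 => M 0 i)).
  exact: initial_continuous.
exact: coord_continuous.
Qed.

Lemma cvg_simplex (Z : topologicalType) n (f : Z -> @stdsimplex R n) (z : Z) :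
  (forall i, val (f y) 0 i @[y --> z] --> val (f z) 0 i) ->
  f y @[y --> z] --> f z.
Proof.
move=> fi W [/= V [[V' oV' <-] /= V'fz] sV].
have [P PM sPA] : nbhs (val (f z)) V' by exact: open_nbhs_nbhs.
have H : \forall y \near z, forall a b, P a b (val (f y) a b).
  apply: filter_forall => a; apply: filter_forall => b.
  rewrite (ord1 a) in PM *.
  exact: (fi b _ (PM 0 b)).
by apply: filterS H => y Py; apply: sV; apply: sPA => a b; exact: Py.
Qed.

End SimplexCoordinates.

Section StochasticMatrices.
Variable R : realType.

(* The affine [n]-simplices in the standard [m]-simplex, listed by their
   vertices. *)
Definition stochastic m n : set 'M[R]_(n.+1, m.+1) :=
  [set M | (forall i j, 0 <= M i j) /\ forall i, \sum_j M i j = 1].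

Arguments stochastic m n : clear implicits.

Lemma stochastic_ge0 m n (M : stochastic m n) i j : 0 <= val M i j.
Proof. by case: M => M /= /set_mem[]. Qed.

Lemma stochastic_sum m n (M : stochastic m n) i : \sum_j val M i j = 1.
Proof. by case: M => M /= /set_mem[]. Qed.

Lemma stochasticP m n (M N : stochastic m n) :
  (forall i j, val M i j = val N i j) -> M = N.
Proof. by move=> MN; apply/val_inj/matrixP. Qed.

Lemma affine_face_subproof m n (k : 'I_n.+2) (M : stochastic m n.+1) :
  row' k (val M) \in @stochastic m n.
Proof.
rewrite inE; split=> [i j|i]; rewrite ?mxE; first exact: stochastic_ge0.
by under eq_bigr do rewrite mxE; exact: stochastic_sum.
Qed.

Definition affine_face m n (k : 'I_n.+2) (M : stochastic m n.+1) :
  stochastic m n := exist (fun x => x \in _) _ (affine_face_subproof k M).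

Lemma affine_faceE m n (k : 'I_n.+2) (M : stochastic m n.+1) i j :
  val (affine_face k M) i j = val M (fintype.lift k i) j.
Proof. by rewrite mxE. Qed.

Lemma affine_face_face m n (i j : 'I_n.+2) (M : stochastic m n.+2) :
  (i <= j)%N -> affine_face i (affine_face (fintype.lift ord0 j) M) =
                affine_face j (affine_face (widen_ord (leqnSn _) i) M).
Proof.
move=> ij; apply: stochasticP => a b; rewrite !affine_faceE; congr (val M _ _).
by apply: val_inj; rewrite /= /bump; move: ij; lia.
Qed.

Definition cone_mx m n (b : 'rV[R]_m.+1) (M : 'M[R]_(n.+1, m.+1)) :
  'M[R]_(n.+2, m.+1) :=
  \matrix_(i, j) oapp (M ^~ j) (b 0 j) (unlift ord0 i).

Lemma affine_cone_subproof m n (b : @stdsimplex R m) (M : stochastic m n) :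
  cone_mx (val b) (val M) \in @stochastic m n.+1.
Proof.
rewrite inE; split=> [i j|i]; first rewrite mxE.
  by case: unliftP => [k|] _ /=; [exact: stochastic_ge0|exact: simplex_ge0].
under eq_bigr do rewrite mxE.
by case: unliftP => [k|] _ /=; [exact: stochastic_sum|exact: simplex_sum].
Qed.

Definition affine_cone m (b : @stdsimplex R m) n (M : stochastic m n) :
  stochastic m n.+1 := exist (fun x => x \in _) _ (affine_cone_subproof b M).

Lemma affine_cone0 m (b : @stdsimplex R m) n (M : stochastic m n) j :
  val (affine_cone b M) ord0 j = val b 0 j.
Proof. by rewrite mxE unlift_none. Qed.

Lemma affine_coneS m (b : @stdsimplex R m) n (M : stochastic m n) i j :
  val (affine_cone b M) (fintype.lift ord0 i) j = val M i j.
Proof. by rewrite mxE liftK. Qed.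

Lemma affine_face0_cone m (b : @stdsimplex R m) n (M : stochastic m n) :
  affine_face ord0 (affine_cone b M) = M.
Proof. by apply: stochasticP => i j; rewrite affine_faceE affine_coneS. Qed.

Lemma affine_faceS_cone m (b : @stdsimplex R m) n (k : 'I_n.+2)
    (M : stochastic m n.+1) :
  affine_face (fintype.lift ord0 k) (affine_cone b M) =
  affine_cone b (affine_face k M).
Proof.
apply: stochasticP => i j; rewrite affine_faceE.
case: (unliftP ord0 i) => [i'|] ->.
  rewrite affine_coneS affine_faceE -[RHS](affine_coneS b); congr (val (affine_cone b M) _ _).
  by apply: val_inj; rewrite /= /bump; lia.
by rewrite affine_cone0 -(affine_cone0 b M); congr (val (affine_cone b M) _ _); apply: val_inj.
Qed.

Definition barycenter_row m n (M : 'M[R]_(n.+1, m.+1)) : 'rV[R]_m.+1 :=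
  \row_j (n.+1%:R^-1 * \sum_i M i j).

Lemma barycenter_subproof m n (M : stochastic m n) :
  barycenter_row (val M) \in @stdsimplex R m.
Proof.
rewrite inE; split=> [j|]; rewrite ?mxE.
  by rewrite mulr_ge0 ?invr_ge0// sumr_ge0// => i _; exact: stochastic_ge0.
under eq_bigr do rewrite mxE.
rewrite -mulr_sumr exchange_big/=.
under eq_bigr do rewrite stochastic_sum.
by rewrite sumr_const card_ord mulVf// pnatr_eq0.
Qed.

Definition barycenter m n (M : stochastic m n) : @stdsimplex R m :=
  exist (fun x => x \in _) _ (barycenter_subproof M).

Lemma barycenterE m n (M : stochastic m n) j :
  val (barycenter M) 0 j = n.+1%:R^-1 * \sum_i val M i j.
Proof. by rewrite mxE. Qed.

Lemma affine_map_subproof m n (M : stochastic m n) (t : @stdsimplex R n) :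
  val t *m val M \in @stdsimplex R m.
Proof.
rewrite inE; split=> [j|].
  rewrite mxE sumr_ge0// => i _.
  by rewrite mulr_ge0//; [exact: simplex_ge0|exact: stochastic_ge0].
under eq_bigr do rewrite mxE.
rewrite exchange_big/= -(simplex_sum t); apply: eq_bigr => i _.
by rewrite -mulr_sumr stochastic_sum mulr1.
Qed.

Definition affine_map m n (M : stochastic m n) (t : @stdsimplex R n) :
  @stdsimplex R m := exist (fun x => x \in _) _ (affine_map_subproof M t).

Lemma affine_mapE m n (M : stochastic m n) t j :
  val (affine_map M t) 0 j = \sum_i val t 0 i * val M i j.
Proof. by rewrite mxE. Qed.

Lemma affine_map_continuous m n (M : stochastic m n) :
  continuous (affine_map M).
Proof.
move=> t; apply: cvg_simplex => j; rewrite affine_mapE.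
under eq_fun do rewrite affine_mapE.
have tF : Filter (nbhs t) by exact: nbhs_filter.
by apply: cvg_sumr => i; apply: cvgMr_tmp; exact: coord_simplex_continuous.
Qed.

HB.instance Definition _ m n (M : stochastic m n) :=
  @isContinuous.Build (@stdsimplex R n) (@stdsimplex R m) (affine_map M)
    (@affine_map_continuous m n M).

Lemma affine_comp_subproof m n p (N : stochastic n p) (M : stochastic m n) :
  val N *m val M \in @stochastic m p.
Proof.
rewrite inE; split=> [i j|i].
  rewrite mxE sumr_ge0// => k _; rewrite mulr_ge0//; exact: stochastic_ge0.
under eq_bigr do rewrite mxE.
rewrite exchange_big/= -(stochastic_sum N i); apply: eq_bigr => k _.
by rewrite -mulr_sumr stochastic_sum mulr1.
Qed.

Definition affine_comp m n (M : stochastic m n) p (N : stochastic n p) :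
  stochastic m p := exist (fun x => x \in _) _ (affine_comp_subproof N M).

Lemma affine_compE m n p (N : stochastic n p) (M : stochastic m n) i j :
  val (affine_comp M N) i j = \sum_k val N i k * val M k j.
Proof. by rewrite mxE. Qed.

Lemma affine_face_comp m n p (k : 'I_p.+2) (N : stochastic n p.+1)
  (M : stochastic m n) :
  affine_face k (affine_comp M N) = affine_comp M (affine_face k N).
Proof.
apply: stochasticP => i j; rewrite affine_faceE !affine_compE.
by under [RHS]eq_bigr do rewrite affine_faceE.
Qed.

Lemma affine_cone_comp m n p b (N : stochastic n p) (M : stochastic m n) :
  affine_comp M (affine_cone b N) =
  affine_cone (affine_map M b) (affine_comp M N).
Proof.
apply: stochasticP => i j; rewrite affine_compE.
case: (unliftP ord0 i) => [i'|] ->.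
  rewrite affine_coneS affine_compE.
  by under eq_bigr do rewrite affine_coneS.
rewrite affine_cone0 affine_mapE.
by under eq_bigr do rewrite affine_cone0.
Qed.

Lemma barycenter_comp m n p (N : stochastic n p) (M : stochastic m n) :
  barycenter (affine_comp M N) = affine_map M (barycenter N).
Proof.
apply: simplexP => j; rewrite barycenterE affine_mapE.
under eq_bigr do rewrite affine_compE.
rewrite exchange_big/= mulr_sumr; apply: eq_bigr => k _.
by rewrite barycenterE -mulrA mulr_suml.
Qed.

Lemma affine_map_comp m n p (N : stochastic n p) (M : stochastic m n) t :
  affine_map (affine_comp M N) t = affine_map M (affine_map N t).
Proof. by apply: val_inj; rewrite /= mulmxA. Qed.

Lemma affine_id_subproof n : 1%:M \in @stochastic n n.
Proof.
rewrite inE; split=> [i j|i]; first by rewrite mxE ler0n.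
rewrite (bigD1 i)//= mxE eqxx big1 ?addr0// => j ji.
by rewrite mxE eq_sym (negbTE ji).
Qed.

Definition affine_id n : stochastic n n :=
  exist (fun x => x \in _) _ (affine_id_subproof n).

Lemma affine_map_id n t : affine_map (affine_id n) t = t.
Proof. by apply: val_inj; rewrite /= mulmx1. Qed.

Lemma affine_comp_id n m (M : stochastic m n) : affine_comp M (affine_id n) = M.
Proof. by apply: val_inj; rewrite /= mul1mx. Qed.

Lemma affine_map_face m n (k : 'I_n.+2) (M : stochastic m n.+1) t :
  affine_map (affine_face k M) t = affine_map M (face_map k t).
Proof.
apply: simplexP => j; rewrite !affine_mapE (bigD1_ord k)//= mxE unlift_none/=.
rewrite mul0r add0r; apply: eq_bigr => i _.
by rewrite !mxE liftK.
Qed.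

Definition affine_sd m := @sd (@stochastic m) (@affine_face m)
  (@stdsimplex R m) (@affine_cone m) (@barycenter m).

Definition affine_sd_homotopy m := @sd_homotopy (@stochastic m) (@affine_face m)
  (@stdsimplex R m) (@affine_cone m) (@barycenter m).

Definition mesh_le m n (e : R) : set (stochastic m n) :=
  [set M : stochastic m n | forall i i' j, `|val M i j - val M i' j| <= e].

(** The coordinatewise bounding box of the vertices replaces their convex hull; this suffices since
    the mesh is measured coordinate by coordinate. *)
Definition in_hull m n n' (M : stochastic m n) : set (stochastic m n') :=
  [set N : stochastic m n' | forall lo hi j, (forall i, lo <= val M i j <= hi) ->
    forall i, lo <= val N i j <= hi].

Lemma barycenter_bounds m n (M : stochastic m n) lo hi j :
  (forall i, lo <= val M i j <= hi) -> lo <= val (barycenter M) 0 j <= hi.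
Proof.
move=> h; rewrite barycenterE.
have n0 : 0 < n.+1%:R :> R by rewrite ltr0n.
rewrite [X in _ <= X <= _]mulrC ler_pdivlMr// ler_pdivrMr//.
have sumE (c : R) : c *+ n.+1 = \sum_(i < n.+1) c by rewrite sumr_const card_ord.
rewrite !mulr_natr !sumE; apply/andP; split; apply: ler_sum => i _;
  by case/andP: (h i).
Qed.

Lemma affine_sd_in_hull m n (M : stochastic m n) :
  supported (@in_hull m n n M) (affine_sd << M >>).
Proof.
elim: n M => [|n IHn] M.
  by change (supported (@in_hull m 0 0 M) << M >>); exact: supportedU.
rewrite /affine_sd sdS bdU !raddf_sum; apply: supported_sum => k _.
rewrite !additiveZint; apply: supportedZ.
apply: (chain_map_supported _ (IHn (affine_face k M))) => N hN lo hi j h i.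
case: (unliftP ord0 i) => [i'|] ->.
  by rewrite affine_coneS; apply: hN => i''; rewrite affine_faceE.
by rewrite affine_cone0; exact: barycenter_bounds.
Qed.

(** The difference is the average of [n.+1] differences of vertices, one of which is zero. *)
Lemma barycenter_dist m n (M : stochastic m n) e k j : mesh_le e M ->
  `|val M k j - val (barycenter M) 0 j| <= n%:R / n.+1%:R * e.
Proof.
move=> eM; rewrite barycenterE.
have n0 : 0 < n.+1%:R :> R by rewrite ltr0n.
have -> : val M k j = n.+1%:R^-1 * \sum_(i < n.+1) val M k j.
  by rewrite sumr_const card_ord -[val M k j *+ _]mulr_natl mulKf// gt_eqF.
rewrite -mulrBr -sumrB normrM gtr0_norm ?invr_gt0// mulrAC [leRHS]mulrC.
rewrite ler_pM2l ?invr_gt0// (le_trans (ler_norm_sum _ _ _))//.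
rewrite (bigD1 k)//= subrr normr0 add0r.
apply: (@le_trans _ _ (\sum_(i < n.+1 | i != k) e)).
  by apply: ler_sum => i _; exact: eM.
by rewrite sumr_const cardC1 card_ord/= mulr_natl.
Qed.

(** Two vertices in a subdivided face are close by induction, since n/(n+1) increases with n. A
    vertex of that face is in the bounding box of vertices of [M], hence close to the barycenter by
    [barycenter_dist]. *)
Lemma affine_sd_mesh m n (M : stochastic m n) e : mesh_le e M ->
  supported (mesh_le (n%:R / n.+1%:R * e)) (affine_sd << M >>).
Proof.
elim: n M => [|n IHn] M eM.
  change (supported (mesh_le (0 / 1 * e)) << M >>); apply: supportedU.
  by move=> i i' j; rewrite !ord1 subrr normr0 !mul0r.
have e0 : 0 <= e.
  by rewrite (le_trans _ (eM ord0 ord0 ord0))// normr_ge0.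
rewrite /affine_sd sdS bdU !raddf_sum; apply: supported_sum => k _.
rewrite !additiveZint; apply: supportedZ.
have eMk : mesh_le e (affine_face k M) by move=> i i' j; rewrite !affine_faceE.
have hb N j i : in_hull (affine_face k M) N ->
    `|val (N : stochastic m n) i j - val (barycenter M) 0 j| <=
      n.+1%:R / n.+2%:R * e.
  move=> hN; rewrite ler_distl; apply: hN => i'.
  by rewrite -ler_distl affine_faceE; exact: barycenter_dist.
apply: (chain_map_supported _
  (supportedI (affine_sd_in_hull (M := affine_face k M)) (IHn _ eMk))).
move=> N [hN eN] i i' j.
case: (unliftP ord0 i) => [a|] ->; case: (unliftP ord0 i') => [b|] ->;
  rewrite ?affine_coneS ?affine_cone0.
- apply: (le_trans (eN a b j)); rewrite ler_wpM2r//.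
  rewrite ler_pdivrMr ?ltr0n// mulrAC ler_pdivlMr ?ltr0n// -!natrM ler_nat.
  lia.
- exact: hb.
- by rewrite distrC; exact: hb.
- by rewrite subrr normr0 mulr_ge0// divr_ge0.
Qed.

End StochasticMatrices.

(** * Small singular chains *)

Section SimplexCompact.
Variable R : realType.

Lemma stdsimplex_compact n : compact (@stdsimplex R n).
Proof.
apply: (@subclosed_compact _ _
    [set v : 'rV[R]_n.+1 | forall i, `[0, 1]%classic (v ord0 i)]); last 2 first.
- exact: (@rV_compact R _ (fun=> `[0, 1]%classic) (fun=> @segment_compact R 0 1)).
- move=> t [t0 t1] i /=; rewrite in_itv/= t0/= -t1 (bigD1 i)//= lerDl.
  by rewrite sumr_ge0.
have -> : @stdsimplex R n = \bigcap_i [set t : 'rV[R]_n.+1 | 0 <= t 0 i] `&`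
    [set t | \sum_i t 0 i = 1].
  apply/seteqP; split=> t [t0 t1]; split=> // i; first by move=> _; exact: t0.
  exact: t0.
apply: closedI.
  apply: closed_bigI => i _.
  apply: (@closed_comp _ _ (fun t : 'rV[R]_n.+1 => t 0 i) [set x | 0 <= x]);
    last exact: closed_ge.
  by move=> t _; exact: coord_continuous.
apply: (@closed_comp _ _ (fun t : 'rV[R]_n.+1 => \sum_i t 0 i) [set 1]);
  last exact: closed_eq.
move=> t _; have tF : Filter (nbhs t) by exact: nbhs_filter.
by apply: cvg_sumr => i; exact: coord_continuous.
Qed.

Lemma simplex_compact n : compact [set: @stdsimplex R n].
Proof.
apply/compact_near_coveringP => I F P FF cov.
have /compact_near_coveringP/near_covering_withinP := @stdsimplex_compact n.
move=> /(_ _ F (fun i x => forall t : @stdsimplex R n, val t = x -> P i t) FF).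
have covK x : @stdsimplex R n x -> \forall x' \near x & i \near F,
    stdsimplex x' -> forall t : @stdsimplex R n, val t = x' -> P i t.
  move=> Kx; pose t0 : @stdsimplex R n := exist (fun x => x \in _) x (mem_set Kx).
  have [[A B] /= [[V [[W oW <-] /= Wx] WA] FB] AB] := cov t0 Logic.I.
  exists (W, B); first by split=> //=; exact: open_nbhs_nbhs.
  by move=> [x' i] /= [Wx' Bi] _ t tx'; apply: (AB (t, i)); split => //=;
    apply: WA; rewrite /= set_valE/= tx'.
move=> /(_ covK); apply: filterS => i h t _; apply: (h (val t)) => //.
by apply/set_mem; exact: valP.
Qed.

Lemma simplex_nbhs_box n (t : @stdsimplex R n) (A : set (@stdsimplex R n)) :
  nbhs t A -> exists2 e : R, 0 < e &
    forall u : @stdsimplex R n, (forall j, `|val t 0 j - val u 0 j| < e) -> A u.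
Proof.
move=> [V [[W oW <-] /= Wt] WA].
have : nbhs (val t) W by exact: open_nbhs_nbhs.
move=> /nbhs_ballP[e /= e0 he]; exists e => // u tu; apply: WA.
by apply: he; split=> // i j /=; rewrite (ord1 i); exact: tu.
Qed.

(** Lebesgue numbers. Around each point, [P e] holds for all small [e]; compactness, used as a
    near-covering property for the filter at [0^'+], makes [e] uniform. *)
Lemma simplex_lebesgue n (I : Type) (V : I -> set (@stdsimplex R n)) :
  (forall t, exists2 i, open (V i) & V i t) -> exists2 e : R, 0 < e &
    forall t : @stdsimplex R n, exists i, forall u : @stdsimplex R n,
      (forall j, `|val t 0 j - val u 0 j| <= e) -> V i u.
Proof.
pose P (e : R) (t : @stdsimplex R n) := exists i, forall u : @stdsimplex R n,
  (forall j, `|val t 0 j - val u 0 j| <= e) -> V i u.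
move=> cov; have /compact_near_coveringP := @simplex_compact n.
move=> /(_ _ (0^'+) P (at_right_proper_filter 0)) H.
have {}H : \forall e \near 0^'+, [set: @stdsimplex R n] `<=` P e.
  apply: H => t.
  move=> _; have [i oVi Vit] := cov t.
  have [e e0 he] := simplex_nbhs_box (open_nbhs_nbhs (conj oVi Vit)).
  have e20 : 0 < e / 2 by rewrite divr_gt0.
  exists ([set t' : @stdsimplex R n | forall j, `|val t 0 j - val t' 0 j| < e / 2],
          [set d : R | d < e / 2]).
    split=> /=; last exact: nbhs_right_lt.
    have tF : Filter (nbhs t) by exact: nbhs_filter.
    apply: (@filter_forall _ _ _ _ tF) => j.
    by have /cvgrPdist_lt/(_ _ e20) := @coord_simplex_continuous R n j t.
  move=> [t' d] /= [tt' de]; exists i => u t'u; apply: he => j.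
  rewrite (le_lt_trans (ler_distD (val t' 0 j) _ _))// [ltRHS]splitr.
  by rewrite ltrD// (le_lt_trans (t'u j)).
have [e [e0 he]] : exists e : R, 0 < e /\ [set: @stdsimplex R n] `<=` P e.
  apply: (@filter_ex _ (0^'+ : set_system R)).
  by apply: filterI => //; exact: nbhs_right_gt.
by exists e => // t; exact: he.
Qed.

End SimplexCompact.

Section SmallSingularChains.
Variables (R : realType) (T : topologicalType).

Local Notation sing := (singular_simplex R T).
Local Notation face := (@singular_face R T).

Lemma singularP n (s t : sing n) : s =1 t -> s = t.
Proof. by move/continuousEP. Qed.

Definition sing_affine m (s : sing m) n (M : @stochastic R m n) : sing n :=
  s \o affine_map M.

Lemma sing_affine_id n (s : sing n) : sing_affine s (affine_id R n) = s.
Proof. by apply: singularP => t; rewrite /sing_affine/= affine_map_id. Qed.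

Lemma sing_affine_comp m n p (s : sing m) (M : @stochastic R m n)
    (N : @stochastic R n p) :
  sing_affine (sing_affine s M) N = sing_affine s (affine_comp M N).
Proof. by apply: singularP => t; rewrite /sing_affine/= affine_map_comp. Qed.

Lemma singular_face_affine m n (s : sing m) (M : @stochastic R m n.+1) k :
  singular_face k (sing_affine s M) = sing_affine s (affine_face k M).
Proof.
by apply: singularP => t; rewrite /sing_affine/singular_face/= affine_map_face.
Qed.

Lemma singular_faceE n (s : sing n.+1) k :
  singular_face k s = sing_affine s (affine_face k (affine_id R n.+1)).
Proof. by rewrite -singular_face_affine sing_affine_id. Qed.

Lemma singular_face_face n (i j : 'I_n.+2) (s : sing n.+2) : (i <= j)%N ->
  singular_face i (singular_face (fintype.lift ord0 j) s) =
  singular_face j (singular_face (widen_ord (leqnSn _) i) s).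
Proof.
by move=> ij; rewrite -[s]sing_affine_id !singular_face_affine affine_face_face.
Qed.

(** The subdivided identity simplex is pushed forward along [s]. *)
Definition sing_sd n : {freeg (sing n) / int} -> {freeg (sing n) / int} :=
  fglift (fun s => chain_map (@sing_affine n s n) (affine_sd << affine_id R n >>)).

HB.instance Definition _ n := GRing.Additive.copy (@sing_sd n) (fglift
  (fun s => chain_map (@sing_affine n s n) (affine_sd << affine_id R n >>))).

Definition sing_sd_homotopy n :
    {freeg (sing n) / int} -> {freeg (sing n.+1) / int} :=
  fglift (fun s =>
    chain_map (@sing_affine n s n.+1) (affine_sd_homotopy << affine_id R n >>)).

HB.instance Definition _ n := GRing.Additive.copy (@sing_sd_homotopy n)
  (fglift (fun s =>
    chain_map (@sing_affine n s n.+1) (affine_sd_homotopy << affine_id R n >>))).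

Lemma sing_sdU n (s : sing n) :
  sing_sd << s >> = chain_map (@sing_affine n s n) (affine_sd << affine_id R n >>).
Proof. exact: fgliftU1. Qed.

Lemma sing_sd_homotopyU n (s : sing n) : sing_sd_homotopy << s >> =
  chain_map (@sing_affine n s n.+1) (affine_sd_homotopy << affine_id R n >>).
Proof. exact: fgliftU1. Qed.

Lemma sing_sd_affine m n (s : sing m) (c : {freeg (@stochastic R m n) / int}) :
  sing_sd (chain_map (@sing_affine m s n) c) =
  chain_map (@sing_affine m s n) (affine_sd c).
Proof.
move: c; apply: (@eq_freeg _ _ (@sing_sd n \o chain_map (@sing_affine m s n))
  (chain_map (@sing_affine m s n) \o @sd _ (@affine_face R m) _ _ _ n)) => M /=.
rewrite chain_mapU sing_sdU.
rewrite -[X in _ = chain_map _ (sd _ _ _ << X >>)]affine_comp_id.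
rewrite -(chain_mapU (@affine_comp R m n M n)).
rewrite (sd_chain_map (baryX := @barycenter R n) (coneX := @affine_cone R n)
  (d := @affine_face R n) (g := affine_map M)).
- rewrite chain_map_comp; congr chain_map.
  by apply/funext => N; exact: sing_affine_comp.
- by move=> *; exact: affine_face_comp.
- by move=> *; exact: affine_cone_comp.
- by move=> *; exact: barycenter_comp.
Qed.

Lemma sing_sd_homotopy_affine m n (s : sing m)
    (c : {freeg (@stochastic R m n) / int}) :
  sing_sd_homotopy (chain_map (@sing_affine m s n) c) =
  chain_map (@sing_affine m s n.+1) (affine_sd_homotopy c).
Proof.
move: c; apply: (@eq_freeg _ _
  (@sing_sd_homotopy n \o chain_map (@sing_affine m s n))
  (chain_map (@sing_affine m s n.+1) \o
   @sd_homotopy _ (@affine_face R m) _ _ _ n)) => M /=.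
rewrite chain_mapU sing_sd_homotopyU.
rewrite -[X in _ = chain_map _ (sd_homotopy _ _ _ << X >>)]affine_comp_id.
rewrite -(chain_mapU (@affine_comp R m n M n)).
rewrite (sd_homotopy_chain_map (baryX := @barycenter R n)
  (coneX := @affine_cone R n) (d := @affine_face R n) (g := affine_map M)).
- rewrite chain_map_comp; congr chain_map.
  by apply/funext => N; exact: sing_affine_comp.
- by move=> *; exact: affine_face_comp.
- by move=> *; exact: affine_cone_comp.
- by move=> *; exact: barycenter_comp.
Qed.

Lemma bd_sing_affine m n (s : sing m) (c : {freeg (@stochastic R m n.+1) / int}) :
  bd face (chain_map (@sing_affine m s n.+1) c) =
  chain_map (@sing_affine m s n) (bd (@affine_face R m) c).
Proof. by apply: bd_chain_map => i M; exact: singular_face_affine. Qed.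

Lemma bd_affine_sd_homotopy n (c : {freeg (@stochastic R n n) / int}) :
  bd_sd_homotopy_stmt (@affine_face R n) (@affine_cone R n) (@barycenter R n) c.
Proof.
apply: bd_sd_homotopy.
- by move=> k i j M; exact: affine_face_face.
- by move=> *; exact: affine_face0_cone.
- by move=> *; exact: affine_faceS_cone.
Qed.

Lemma bd_sing_sd_homotopy n (c : {freeg (sing n.+1) / int}) :
  bd face (sing_sd_homotopy c) + sing_sd_homotopy (bd face c) = c - sing_sd c.
Proof.
move: c; apply: (@eq_freeg _ _
  ((@bd _ face n.+1 \o @sing_sd_homotopy n.+1) \+
   (@sing_sd_homotopy n \o @bd _ face n)) (idfun \- @sing_sd n.+1)) => s /=.
rewrite -[in << s >>](sing_affine_id s) -(chain_mapU (@sing_affine _ s n.+1)).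
rewrite sing_sd_homotopy_affine !bd_sing_affine sing_sd_homotopy_affine.
rewrite sing_sd_affine -raddfD -raddfB; congr chain_map.
exact: bd_affine_sd_homotopy (<< affine_id R n.+1 >>).
Qed.

Lemma bd_sing_sd_homotopy0 (c : {freeg (sing 0) / int}) :
  bd face (sing_sd_homotopy c) = c - sing_sd c.
Proof.
move: c; apply: (@eq_freeg _ _ (@bd _ face 0 \o @sing_sd_homotopy 0)
  (idfun \- @sing_sd 0)) => s /=.
rewrite -[in << s >>](sing_affine_id s) -(chain_mapU (@sing_affine _ s 0)).
rewrite sing_sd_homotopy_affine !bd_sing_affine sing_sd_affine -raddfB.
by congr chain_map; exact: bd_affine_sd_homotopy (<< affine_id R 0 >>).
Qed.

Variable F : forall n, set (sing n).
Hypothesis F_affine : forall m n (s : sing m) (M : @stochastic R m n),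
  F s -> F (sing_affine s M).

Lemma F_face n (k : 'I_n.+2) (s : sing n.+1) : F s -> F (singular_face k s).
Proof. by rewrite singular_faceE; exact: F_affine. Qed.

Lemma sing_sd_homotopy_F n c :
  supported (@F n) c -> supported (@F n.+1) (sing_sd_homotopy c).
Proof.
apply: fglift_supported => s Fs.
by apply: (@chain_map_supported _ _ _ setT) => // M _; exact: F_affine.
Qed.

(** A singular simplex has no mesh of its own, so iterated subdivision must remember a presentation
    by an original simplex and an affine one. *)
Definition mesh_from n (A : set (sing n)) (e : R) : set (sing n) :=
  [set s | exists2 t, A t &
     exists2 M : @stochastic R n n, mesh_le e M & s = sing_affine t M].

Lemma sing_sd_mesh n (A : set (sing n)) e c :
  supported (mesh_from A e) c ->
  supported (mesh_from A (n%:R / n.+1%:R * e)) (sing_sd c).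
Proof.
apply: fglift_supported => s [t At [M eM ->]].
rewrite -sing_sdU.
rewrite -(chain_mapU (@sing_affine _ t n)) sing_sd_affine.
apply: (chain_map_supported _ (affine_sd_mesh eM)) => N eN.
by exists t => //; exists N.
Qed.

(** After subtracting the boundary of the homotopy of [c], what remains is the homotopy of the
    boundary of [c]; it stays in [F] because [F] is stable under affine reparametrization. *)
Lemma rel_boundary_sd n (c : {freeg (sing n) / int}) : rel_cycle face F c ->
  rel_boundary face F setT (c - sing_sd c).
Proof.
case: n c => [|n] c /= hc; exists (sing_sd_homotopy c) => //.
  by rewrite bd_sing_sd_homotopy0 subrr; exact: supported0.
rewrite -bd_sing_sd_homotopy addrAC subrr add0r; exact: sing_sd_homotopy_F.
Qed.

Lemma rel_cycle_boundary n (c1 c2 : {freeg (sing n) / int}) :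
  rel_boundary face F setT (c1 - c2) -> rel_cycle face F c1 ->
  rel_cycle face F c2.
Proof.
move=> [e _ he] h1.
have dd := singular_face_face.
have : rel_cycle face F (c2 + bd face e).
  apply: rel_cycle_sub h1 => //; first exact: F_face.
  by rewrite opprD addrA.
move=> h; rewrite -(addrK (bd face e) c2).
by apply: rel_cycleB => //; apply: rel_cycle_bd.
Qed.

Lemma rel_boundary_mesh n k (c : {freeg (sing n) / int}) : rel_cycle face F c ->
  exists c', [/\ rel_boundary face F setT (c - c'), rel_cycle face F c' &
    supported (mesh_from [set s | s \in dom c] ((n%:R / n.+1%:R) ^+ k)) c'].
Proof.
move=> hc; elim: k => [|k [c' [bc' hc' sc']]].
  exists c; split=> //.
    by rewrite subrr; apply: rel_boundary_F; exact: supported0.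
  move=> s sc; exists s => //; exists (affine_id R n).
    move=> i i' j; rewrite expr0 !mxE.
    by case: eqP => _; case: eqP => _; rewrite ?subrr ?subr0 ?sub0r ?normrN ?normr0 ?normr1.
  by rewrite sing_affine_id.
have bd' := rel_boundary_sd hc'.
exists (sing_sd c'); split; last by rewrite exprS; exact: sing_sd_mesh.
- rewrite (_ : c - _ = (c - c') + (c' - sing_sd c')); last first.
    by rewrite addrA subrK.
  exact: rel_boundaryD.
- exact: rel_cycle_boundary hc'.
Qed.

Lemma sing_affine_small (I : Type) (O : I -> set T) n (s : sing n) :
  (forall x, exists2 i, open (O i) & O i x) -> exists2 e : R, 0 < e &
    forall M : @stochastic R n n, mesh_le e M ->
      exists i, range (sing_affine s M) `<=` O i.
Proof.
move=> cov; have [t|e e0 he] := @simplex_lebesgue R n I (fun i => s @^-1` O i).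
  have [i oi Ois] := cov (s t); exists i => //.
  by apply: open_comp => // u _; exact: cts_fun.
exists e => // M eM.
(* The Lebesgue property is used at vertex 0 of [M]: every point of the affine simplex is an average
   of vertices, all within [e] of this one. *)
have vP : row ord0 (val M) \in @stdsimplex R n.
  rewrite inE; split=> [j|]; rewrite ?mxE; first exact: stochastic_ge0.
  by under eq_bigr do rewrite mxE; exact: stochastic_sum.
have [i hi] := he (exist (fun x => x \in _) _ vP).
exists i => _ [t _ <-]; apply: hi => j.
rewrite affine_mapE mxE -[val M ord0 j]mul1r -(simplex_sum t) mulr_suml -sumrB.
rewrite (le_trans (ler_norm_sum _ _ _))// -[e]mul1r -(simplex_sum t) mulr_suml.
apply: ler_sum => k _; rewrite -mulrBr normrM ger0_norm ?simplex_ge0//.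
by rewrite ler_wpM2l ?simplex_ge0.
Qed.

Lemma rel_boundary_small (I : Type) (O : I -> set T) n
    (c : {freeg (sing n) / int}) :
  (forall x, exists2 i, open (O i) & O i x) -> rel_cycle face F c ->
  exists c', [/\ rel_boundary face F setT (c - c'), rel_cycle face F c' &
    supported [set s : sing n | exists i, range s `<=` O i] c'].
Proof.
move=> cov hc.
(* A chain has finitely many simplices, so one Lebesgue number serves them all. *)
have [e e0 he] : exists2 e : R, 0 < e & forall s, s \in dom c ->
    forall M : @stochastic R n n, mesh_le e M ->
      exists i, range (sing_affine s M) `<=` O i.
  elim: (dom c) => [|s l [e e0 he]]; first by exists 1.
  have [e' e'0 he'] := sing_affine_small s cov.
  exists (Num.min e e'); first by rewrite lt_min e0.
  move=> s' + M eM; rewrite inE => /orP[/eqP->|s'l].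
    by apply: he' => a b j; have := eM a b j; rewrite le_min => /andP[].
  by apply: he => // a b j; have := eM a b j; rewrite le_min => /andP[].
have [k ke] : exists k : nat, (n%:R / n.+1%:R : R) ^+ k <= e.
  have : (fun k => (n%:R / n.+1%:R : R) ^+ k) @ \oo --> (0 : R).
    apply: cvg_expr; rewrite ger0_norm ?divr_ge0// ltr_pdivrMr ?ltr0n//.
    by rewrite mul1r ltr_nat.
  move=> /cvgrPdist_le/(_ _ e0)[k _ /(_ k (leqnn k))]/=.
  by rewrite sub0r normrN => h; exists k; exact: le_trans (ler_norm _) h.
have [c' [bc' hc' sc']] := rel_boundary_mesh k hc.
exists c'; split=> // s /sc'[t tc [M eM ->]]; apply: he => // a b j.
exact: le_trans ke.
Qed.

End SmallSingularChains.

Lemma seq_pos_bound (R : realType) (T : eqType) (s : seq T)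
    (P : T -> R -> Prop) :
  (forall t e e', P t e -> e' <= e -> P t e') ->
  (forall t, t \in s -> exists2 e, 0 < e & P t e) ->
  exists2 e, 0 < e & forall t, t \in s -> P t e.
Proof.
move=> Ple; elim: s => [|t s IHs] h; first by exists 1.
have [|e e0 he] := IHs; first by move=> u us; apply: h; rewrite inE us orbT.
have [|e' e'0 he'] := h t; first by rewrite inE eqxx.
exists (Num.min e e'); first by rewrite lt_min e0.
move=> u; rewrite inE => /orP[/eqP->|/he hu].
  by apply: Ple he' _; rewrite ge_min lexx orbT.
by apply: Ple hu _; rewrite ge_min lexx.
Qed.

(** * The topology of the thickening *)

Section Expectation.
Variables (R : realType) (X : choiceType).
Implicit Types (p q : {fsfun X -> R with 0}) (f g : X -> R)
  (A B : set X).

Definition expect f p : R := \sum_(x <- finsupp p) p x * f x.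

Definition mass (A : set X) p : R := expect \1_A p.

Lemma expectE (S : {fset X}) f p : (finsupp p `<=` S)%fset ->
  expect f p = \sum_(x <- S) p x * f x.
Proof.
move=> pS; rewrite /expect (big_fset_incl _ pS)// => x _.
by rewrite memNfinsupp => /eqP->; rewrite mul0r.
Qed.

Lemma eq_expect f g p :
  {in finsupp p, forall x, f x = g x} -> expect f p = expect g p.
Proof.
by move=> fg; rewrite /expect big_seq [RHS]big_seq; apply: eq_bigr => x /fg->.
Qed.

Lemma expect_cst p c : fin_prob p -> expect (fun=> c) p = c.
Proof. by move=> [_ p1]; rewrite /expect -mulr_suml p1 mul1r. Qed.

Lemma ler_expect p f g : fin_prob p ->
  {in finsupp p, forall x, f x <= g x} -> expect f p <= expect g p.
Proof.
move=> [p0 _] fg; rewrite /expect big_seq [leRHS]big_seq.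
by apply: ler_sum => x xp; rewrite ler_wpM2l ?fg.
Qed.

Lemma expect_ge0 p f : fin_prob p ->
  {in finsupp p, forall x, 0 <= f x} -> 0 <= expect f p.
Proof.
move=> pp f0; apply: le_trans (ler_expect pp f0).
by rewrite expect_cst.
Qed.

Lemma expectB p f g : expect (fun x => f x - g x) p = expect f p - expect g p.
Proof. by rewrite /expect -sumrB; apply: eq_bigr => x _; rewrite mulrBr. Qed.

Lemma expect_sum p (I : Type) (r : seq I) (f : I -> X -> R) :
  expect (fun x => \sum_(i <- r) f i x) p = \sum_(i <- r) expect (f i) p.
Proof.
by rewrite /expect exchange_big/=; apply: eq_bigr => x _; rewrite mulr_sumr.
Qed.

Lemma expect_indic1 x p : mass [set x] p = p x.
Proof.
rewrite /mass (expectE _ (fsubsetUr [fset x]%fset (finsupp p))).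
rewrite (big_fsetD1 x)/=; last by rewrite !inE eqxx.
rewrite indicE mem_set// mulr1 big_seq big1 ?addr0// => y.
by rewrite !inE indicE => /andP[/eqP yx _]; rewrite memNset// mulr0.
Qed.

Lemma mass_ge0 p A : fin_prob p -> 0 <= mass A p.
Proof. by move=> pp; apply: expect_ge0 => // x _; rewrite indicE. Qed.

Lemma mass_le1 p A : fin_prob p -> mass A p <= 1.
Proof.
by move=> pp; rewrite -[leRHS](expect_cst 1 pp); exact: ler_expect.
Qed.

Lemma ler_mass p A B : fin_prob p ->
  (forall x, x \in finsupp p -> A x -> B x) -> mass A p <= mass B p.
Proof.
move=> pp AB; apply: ler_expect => // x xp; rewrite !indicE ler_nat.
by case: (boolP (x \in A)) => [/set_mem/(AB _ xp)/mem_set->|].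
Qed.

Lemma mass_eq1 p A : fin_prob p -> [set` finsupp p] `<=` A -> mass A p = 1.
Proof.
move=> pp pA; rewrite -[RHS](expect_cst 1 pp); apply: eq_expect => x xp.
by rewrite indicE mem_set//; exact: pA.
Qed.

Lemma mass_gt0 p A : 0 < mass A p -> exists2 x, x \in finsupp p & A x.
Proof.
move=> h; apply: contrapT => nA; move: h; rewrite /mass.
rewrite (_ : expect _ _ = 0) ?ltxx// /expect big_seq big1// => x xp.
rewrite indicE memNset ?mulr0// => Ax; apply: nA; exists x => //.
Qed.

Lemma fin_prob_neq0 p : fin_prob p -> exists x, x \in finsupp p.
Proof.
move=> pp; have := @mass_gt0 p setT.
rewrite mass_eq1// => -[]// x xp _; by exists x.
Qed.

End Expectation.

(** * Lower and upper bounds for the Wasserstein distance *)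

Section WassersteinBounds.
Variables (R : realType) (X : metricType R).
Implicit Types (p q : {fsfun X -> R with 0}).

(** The easy half of Kantorovich duality. Two functions are allowed so that it applies to the
    indicators of a set and of a neighbourhood of it. *)
Lemma wasserstein_lipschitz p q (f g : X -> R) (L : R) :
  fin_prob p -> fin_prob q -> 0 < L ->
  {in finsupp p & finsupp q, forall x y, f x - g y <= L * mdist x y} ->
  expect f p - expect g q <= L * wasserstein p q.
Proof.
move=> pp pq L0 fg; rewrite -ler_pdivrMl//.
apply: le_wasserstein => // m [m0 m1 m2]; rewrite ler_pdivrMl//.
have -> : expect f p =
    \sum_(x <- finsupp p) \sum_(y <- finsupp q) m x y * f x.
  rewrite /expect big_seq [RHS]big_seq; apply: eq_bigr => x xp.
  by rewrite -mulr_suml m1.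
have -> : expect g q =
    \sum_(x <- finsupp p) \sum_(y <- finsupp q) m x y * g y.
  rewrite exchange_big/= /expect big_seq [RHS]big_seq; apply: eq_bigr => y yq.
  by rewrite -mulr_suml m2.
rewrite -sumrB /transport_cost mulr_sumr big_seq [leRHS]big_seq.
apply: ler_sum => x xp; rewrite -sumrB mulr_sumr big_seq [leRHS]big_seq.
apply: ler_sum => y yq; rewrite -mulrBr mulrCA.
by rewrite ler_wpM2l ?m0 ?fg.
Qed.

(* A partial coupling is completed by coupling the two residual measures
   independently. *)
Lemma wasserstein_partial p q (m : X -> X -> R) (C : R) :
  fin_prob p -> fin_prob q ->
  {in finsupp p & finsupp q, forall x y, 0 <= m x y} ->
  {in finsupp p, forall x, \sum_(y <- finsupp q) m x y <= p x} ->
  {in finsupp q, forall y, \sum_(x <- finsupp p) m x y <= q y} ->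
  {in finsupp p & finsupp q, forall x y, mdist x y <= C} ->
  wasserstein p q <= transport_cost p q m +
    C * (1 - \sum_(x <- finsupp p) \sum_(y <- finsupp q) m x y).
Proof.
move=> pp pq m0 m1 m2 dC; set e := 1 - _.
pose a x := p x - \sum_(y <- finsupp q) m x y.
pose b y := q y - \sum_(x <- finsupp p) m x y.
have sa : \sum_(x <- finsupp p) a x = e by rewrite sumrB pp.2.
have sb : \sum_(y <- finsupp q) b y = e by rewrite sumrB pq.2 exchange_big.
have a0 x : x \in finsupp p -> 0 <= a x by move=> xp; rewrite subr_ge0 m1.
have b0 y : y \in finsupp q -> 0 <= b y by move=> yq; rewrite subr_ge0 m2.
have e0 : 0 <= e by rewrite -sa big_seq sumr_ge0.
(* If [e = 0] then [e / e] is 0, but the nonnegative residual masses sum to 0 and vanish too. *)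
have ae x : x \in finsupp p -> a x * (e / e) = a x.
  move=> xp; have [ee|ee] := eqVneq e 0; last by rewrite divff// mulr1.
  have := sa; rewrite ee (big_fsetD1 x)//= => /eqP.
  rewrite paddr_eq0 ?a0//; first by move=> /andP[/eqP-> _]; rewrite mul0r.
  by rewrite big_seq sumr_ge0// => y; rewrite !inE => /andP[_ /a0].
have be y : y \in finsupp q -> b y * (e / e) = b y.
  move=> yq; have [ee|ee] := eqVneq e 0; last by rewrite divff// mulr1.
  have := sb; rewrite ee (big_fsetD1 y)//= => /eqP.
  rewrite paddr_eq0 ?b0//; first by move=> /andP[/eqP-> _]; rewrite mul0r.
  by rewrite big_seq sumr_ge0// => x; rewrite !inE => /andP[_ /b0].
have c : coupling p q (fun x y => m x y + a x * b y / e).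
  split=> [x y xp yq|x xp|y yq].
  - by rewrite addr_ge0 ?m0// divr_ge0// mulr_ge0 ?a0 ?b0.
  - rewrite big_split/= -mulr_suml -mulr_sumr sb -mulrA ae//.
    by rewrite addrC subrK.
  - rewrite big_split/= -mulr_suml -mulr_suml sa [e * _]mulrC -mulrA be//.
    by rewrite addrC subrK.
apply: le_trans (wasserstein_le c) _.
have -> : transport_cost p q (fun x y => m x y + a x * b y / e) =
    transport_cost p q m +
    \sum_(x <- finsupp p) \sum_(y <- finsupp q) a x * b y / e * mdist x y.
  rewrite /transport_cost -big_split/=; apply: eq_bigr => x _.
  by rewrite -big_split/=; apply: eq_bigr => y _; exact: mulrDl.
rewrite lerD2l -[X in C * X]sa mulr_sumr.
rewrite big_seq [leRHS]big_seq; apply: ler_sum => x xp.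
rewrite -[X in C * X]ae// -[X in _ * (X / _)]sb !(mulr_suml, mulr_sumr).
rewrite big_seq [leRHS]big_seq; apply: ler_sum => y yq.
by rewrite mulrA [leRHS]mulrC ler_wpM2l ?dC// divr_ge0// mulr_ge0 ?a0 ?b0.
Qed.

(* The mass of [p] at [x] is moved to the ball of radius [r] around [x]; these
   balls are disjoint. *)
Lemma wasserstein_le_balls p q (r h C : R) :
  fin_prob p -> fin_prob q -> 0 < r -> 0 <= h ->
  {in finsupp p &, forall x y, x != y -> r *+ 2 <= mdist x y} ->
  {in finsupp p & finsupp q, forall x y, mdist x y <= C} ->
  {in finsupp p, forall x, p x - h <= mass (ball x r) q} ->
  wasserstein p q <= r + C * ((size (finsupp p))%:R * h).
Proof.
move=> pp pq r0 h0 sep dC ph.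
pose B x := mass (ball x r) q.
have B0 x : 0 <= B x by exact: mass_ge0.
(* The ball around [x] receives [min (p x) (B x)], spread in proportion to [q]. If [B x = 0], the
   quotient is 0, as it should be. *)
pose m x y := q y * \1_(ball x r) y * (Num.min (p x) (B x) / B x).
have rho0 x : 0 <= Num.min (p x) (B x) / B x.
  by rewrite divr_ge0// le_min pp.1 B0.
have rho1 x : Num.min (p x) (B x) / B x <= 1.
  have [->|Bx] := eqVneq (B x) 0; first by rewrite invr0 mulr0.
  by rewrite ler_pdivrMr ?mul1r ?ge_min ?lexx ?orbT// lt_neqAle eq_sym Bx B0.
have mrow x : \sum_(y <- finsupp q) m x y = Num.min (p x) (B x).
  rewrite -mulr_suml (_ : \sum_(y <- finsupp q) _ = B x)//.
  have [->|Bx] := eqVneq (B x) 0; last by rewrite mulrC divfK.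
  by rewrite mul0r; apply/esym/min_idPr; exact: pp.1.
have m0 x y : 0 <= m x y by rewrite mulr_ge0// mulr_ge0 ?pq.1// indicE.
apply: le_trans (wasserstein_partial pp pq _ _ _ dC) _ => //.
- by move=> x xp; rewrite mrow ge_min lexx.
(* By [sep], [y] lies in at most one ball, so at most one term of the column is nonzero. *)
- move=> y yq.
  have [[x xp yx]|nx] := pselect (exists2 x, x \in finsupp p & ball x r y).
    rewrite (big_fsetD1 x)//= big_seq big1 ?addr0.
      rewrite /m -mulrA ler_piMr ?pq.1// indicE mem_set// mul1r//.
    move=> x'; rewrite !inE => /andP[x'x x'p].
    rewrite /m indicE memNset ?mulr0 ?mul0r// => yx'.
    have := sep _ _ x'p xp x'x; rewrite leNgt => /negP; apply.
    rewrite (le_lt_trans (metric_triangle _ y _))// mulr2n ltrD//.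
      by move: yx'; rewrite ballEmdist.
    by move: yx; rewrite ballEmdist/= metric_sym.
  rewrite big_seq big1 ?pq.1// => x xp.
  by rewrite /m indicE memNset ?mulr0 ?mul0r// => yx; apply: nx; exists x.
have C0 : 0 <= C.
  have [x xp] := fin_prob_neq0 pp; have [y yq] := fin_prob_neq0 pq.
  by apply: le_trans (dC _ _ xp yq); exact: mdist_ge0.
under [X in _ + _ * (_ - X)]eq_bigr do rewrite mrow.
apply: lerD.
  apply: (@le_trans _ _ (\sum_(x <- finsupp p) p x * r)); last first.
    by rewrite -mulr_suml pp.2 mul1r.
  apply: ler_sum => x _.
  apply: (@le_trans _ _ (\sum_(y <- finsupp q) m x y * r)); last first.
    by rewrite -mulr_suml mrow ler_wpM2r ?ge_min ?lexx// ltW.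
  apply: ler_sum => y _; rewrite /m indicE.
  have [yx|yx] := pselect (ball x r y); last by rewrite memNset// mulr0 !mul0r.
  rewrite mem_set//; move: yx; rewrite ballEmdist/= => yx.
  apply: ler_wpM2l; last exact: ltW.
  by apply: mulr_ge0 => //; rewrite mulr1; exact: pq.1.
(* At each [x] the mass left over is [p x - min (p x) (B x)], at most [h]. *)
rewrite ler_wpM2l// -[X in X - _]pp.2 -sumrB.
have -> : (size (finsupp p))%:R * h = \sum_(x <- finsupp p) h.
  by rewrite big_const_seq count_predT iter_addr_0 mulr_natl.
rewrite big_seq [leRHS]big_seq; apply: ler_sum => x xp.
by rewrite lerBlDr -lerBlDl le_min ph// andbT lerBlDr lerDl.
Qed.

End WassersteinBounds.

Lemma filter_seq (T : Type) (I : eqType) (F : set_system T) (s : seq I)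
    (P : I -> set T) : Filter F ->
  (forall i, i \in s -> F (P i)) -> F [set t | forall i, i \in s -> P i t].
Proof.
move=> FF; elim: s => [|i s IHs] h; first exact: filterE.
have Pi : F (P i) by apply: h; rewrite inE eqxx.
have Ps : F [set t | forall i, i \in s -> P i t].
  by apply: IHs => j js; apply: h; rewrite inE js orbT.
apply: filterS (filterI Pi Ps) => t [Pit Pst] j.
by rewrite inE => /orP[/eqP->|/Pst].
Qed.

Section ThickeningTopology.
Variables (R : realType) (X : metricType R) (U : set (set X)).
Hypothesis Ubounded : uniformly_bounded U.

Local Notation VM := (vietoris_thickening U).

Lemma thickening_fin_prob (p : VM) : fin_prob (val p).
Proof. by case: p => p /= /set_mem[]. Qed.

Lemma thickening_supp (p : VM) :
  exists2 A, U A & [set` finsupp (val p)] `<=` A.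
Proof. by case: p => p /= /set_mem[]. Qed.

Lemma thickening_ge0 (p : VM) x : 0 <= val p x.
Proof. exact: (thickening_fin_prob p).1. Qed.

(** Since the total mass is 1, lower bounds near each point of the finite support of [p] leave
    little mass elsewhere, and uniform boundedness makes moving it cheap. *)
Lemma cvg_thickening (T : Type) (F : set_system T) (f : T -> VM) (p : VM) :
  Filter F ->
  (forall x r h, x \in finsupp (val p) -> 0 < r -> 0 < h ->
    \forall t \near F, val p x - h <= mass (ball x r) (val (f t))) ->
  f @ F --> p.
Proof.
move=> FF fp; apply/metricType_numDomainType.cvgrPdist_le => e e0.
have [D hD] := Ubounded; have pp := thickening_fin_prob p.
have [x0 x0p] := fin_prob_neq0 pp.
have px0 : 0 < val p x0.
  by rewrite lt_neqAle thickening_ge0 andbT eq_sym -mem_finsupp.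
have D0 : 0 <= D.
  have [A UA pA] := thickening_supp p.
  by rewrite -(mdistxx x0); apply: (hD A); rewrite ?UA//; exact: pA.
have [s s0 sep] : exists2 s : R, 0 < s & forall x, x \in finsupp (val p) ->
    forall y, y \in finsupp (val p) -> x != y -> s *+ 2 <= mdist x y.
  apply: seq_pos_bound => [x s s' h ss y yp xy|x xp].
    by apply: le_trans (h y yp xy); rewrite lerMn2r ss orbT.
  apply: seq_pos_bound => [y s s' h ss xy|y yp].
    by apply: le_trans (h xy); rewrite lerMn2r ss orbT.
  have [->|xy] := eqVneq x y; first by exists 1.
  exists (mdist x y / 2); first by rewrite divr_gt0// mdist_gt0.
  by move=> _; rewrite -[_ / 2 *+ 2]mulr_natr divfK.
(* A bound on distances between the two supports: cross the first one to [x0], jump by less than 1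
   to some [y0] in the second, and cross that one. *)
pose C := D + D + 1; pose N := size (finsupp (val p)).
have C0 : 0 < C by rewrite ltr_wpDl// addr_ge0.
pose r := Num.min (Num.min (e / 2) s) 1.
(* The first bound keeps the cost of the leftover mass below [e / 2]; the second guarantees a
   support point [y0] near [x0]. *)
pose h := Num.min (e / 2 / (C * N.+1%:R)) (val p x0 / 2).
have r0 : 0 < r by rewrite !lt_min s0 ltr01 divr_gt0.
have h0 : 0 < h by rewrite lt_min !divr_gt0// mulr_gt0// ltr0n.
have : \forall t \near F, forall x, x \in finsupp (val p) ->
    val p x - h <= mass (ball x r) (val (f t)).
  by apply: filter_seq => x xp; exact: fp.
apply: filterS => t ht.
have qq := thickening_fin_prob (f t).
have [y0 y0q] : exists2 y, y \in finsupp (val (f t)) & ball x0 r y.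
  apply: mass_gt0; apply: lt_le_trans (ht _ x0p).
  rewrite subr_gt0 (@le_lt_trans _ _ (val p x0 / 2))//.
    by rewrite ge_min lexx orbT.
  by rewrite ltr_pdivrMr// ltr_pMr// ltr1n.
rewrite ballEmdist/= => x0y0.
have dC : {in finsupp (val p) & finsupp (val (f t)),
    forall x y, mdist x y <= C}.
  move=> x y xp yq; have [A UA pA] := thickening_supp p.
  have [B UB qB] := thickening_supp (f t).
  rewrite (le_trans (metric_triangle _ x0 _))// /C -addrA.
  apply: lerD; first by apply: (hD A); rewrite ?UA//; exact: pA.
  rewrite (le_trans (metric_triangle _ y0 _))// [leLHS]addrC.
  apply: lerD; first by apply: (hD B); rewrite ?UB//; exact: qB.
  by rewrite ltW// (lt_le_trans x0y0)// ge_min lexx orbT.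
change (wasserstein (val p) (val (f t)) <= e).
apply: (le_trans (wasserstein_le_balls pp qq r0 (ltW h0) _ dC ht)).
  move=> x y xp yp xy; apply: le_trans (sep x xp y yp xy).
  by rewrite lerMn2r/= !ge_min lexx !orbT.
rewrite [leRHS]splitr lerD//; first by rewrite !ge_min lexx.
apply: (@le_trans _ _ (C * N.+1%:R * h)).
  rewrite -mulrA; apply: ler_wpM2l; first exact: ltW.
  by apply: ler_wpM2r; [exact: ltW|rewrite ler_nat].
by rewrite mulrC -ler_pdivlMr ?mulr_gt0 ?ltr0n// ge_min lexx.
Qed.

(** Mass of [p] in [A] that ends outside [B] travels at least [r], so moving an amount [h] of it
    costs at least [h * r]. *)
Lemma near_mass (p : VM) (A B : set X) (r h : R) : 0 < r -> 0 < h ->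
  (forall x, x \in finsupp (val p) -> A x -> ball x r `<=` B) ->
  \forall q \near p, mass A (val p) - h < mass B (val q).
Proof.
move=> r0 h0 AB.
have : nbhs p (ball p (h * r)) by apply: nbhsx_ballx; rewrite mulr_gt0.
apply: filterS => q; rewrite ballEmdist/= => pq.
have r'0 : 0 < r^-1 by rewrite invr_gt0.
have := @wasserstein_lipschitz _ _ (val p) (val q) \1_A \1_B r^-1
  (thickening_fin_prob p) (thickening_fin_prob q) r'0.
move=> H; rewrite ltrBlDr -ltrBlDl; apply: le_lt_trans (H _) _; last first.
  by rewrite mulrC ltr_pdivrMr.
move=> x y xp yq; rewrite !indicE.
have [Ax|Ax] := pselect (A x); last first.
  rewrite (memNset Ax) sub0r (@le_trans _ _ 0) ?oppr_le0//.
  by rewrite mulr_ge0 ?mdist_ge0// ltW.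
rewrite (mem_set Ax); have [By|By] := pselect (B y).
  by rewrite (mem_set By) subrr mulr_ge0 ?mdist_ge0// ltW.
rewrite (memNset By) subr0 mulrC ler_pdivlMr// mul1r leNgt; apply/negP => xy.
by apply: By; apply: (AB x xp Ax); rewrite ballEmdist.
Qed.

Lemma near_mass_ball (p : VM) x (r h : R) : 0 < r -> 0 < h ->
  \forall q \near p, val p x - h < mass (ball x r) (val q).
Proof.
move=> r0 h0; have := @near_mass p [set x] (ball x r) r h r0 h0.
by rewrite expect_indic1; apply=> y _ ->.
Qed.

Lemma open_mass (A : set X) (c : R) : open A ->
  open [set p : VM | c < mass A (val p)].
Proof.
move=> oA; rewrite openE => p /= cp.
have [r r0 hr] : exists2 r : R, 0 < r &
    forall x, x \in finsupp (val p) -> A x -> ball x r `<=` A.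
  apply: seq_pos_bound => [x r r' h rr Ax|x xp].
    by apply: subset_trans (h Ax); exact: le_ball.
  have [Ax|Ax] := pselect (A x); last by exists 1.
  have /nbhs_ballP[r /= r0 hr] : nbhs x A by exact: open_nbhs_nbhs.
  by exists r.
have := @near_mass p A A r (mass A (val p) - c) r0.
rewrite subr_gt0 => /(_ cp hr); apply: filterS => q.
by rewrite subKr.
Qed.

Lemma cvg_expect (g : X -> R) (p : VM) :
  (forall x y, g x - g y <= mdist x y) ->
  expect g (val q) @[q --> p] --> expect g (val p).
Proof.
move=> gL; have pF : Filter (nbhs p) by exact: nbhs_filter.
apply/cvgrPdist_le => e e0.
have : nbhs p (ball p e) by exact: nbhsx_ballx.
apply: filterS => q; rewrite ballEmdist/= => pq.
have pp := thickening_fin_prob p; have qq := thickening_fin_prob q.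
have H p' q' : fin_prob p' -> fin_prob q' ->
    expect g p' - expect g q' <= wasserstein p' q'.
  move=> pp' qq'; rewrite -[leRHS]mul1r; apply: wasserstein_lipschitz => //.
  by move=> x y _ _; rewrite mul1r.
rewrite ler_norml; apply/andP; split; last first.
  by rewrite (le_trans (H _ _ pp qq))// ltW.
by rewrite lerNl opprB (le_trans (H _ _ qq pp))// wasserstein_sym// ltW.
Qed.

End ThickeningTopology.

(** * Contractions of the sets of the cover *)

Section Depth.
Variables (R : realType) (X : metricType R) (G : set X).

Let radii x := [set r : R | 0 <= r <= 1 /\ ball x r `<=` G].

(* The distance to the complement of [G], truncated at 1. *)
Definition depth x : R := sup (radii x).

Let radii0 x : radii x 0.
Proof.
by split; [rewrite lexx ler01|move=> y; rewrite ballEmdist/= ltNge mdist_ge0].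
Qed.

Let radii_sup x : has_sup (radii x).
Proof. by split; [exists 0|exists 1 => r [/andP[]]]. Qed.

Lemma depth_ge0 x : 0 <= depth x.
Proof. by apply: ub_le_sup => //; have [] := radii_sup x. Qed.

Lemma depth_eq0 x : ~ G x -> depth x = 0.
Proof.
move=> nGx; apply/eqP; rewrite eq_le depth_ge0 andbT; apply: ge_sup; first by exists 0.
move=> r [/andP[r0 _] rG]; rewrite leNgt; apply/negP => {}r0.
by apply/nGx/rG; exact: ballxx.
Qed.

Lemma depth_gt0 x : open G -> G x -> 0 < depth x.
Proof.
move=> oG Gx; have /nbhs_ballP[r /= r0 rG] : nbhs x G by exact: open_nbhs_nbhs.
apply: (@lt_le_trans _ _ (Num.min r 1)); first by rewrite lt_min r0 ltr01.
apply: ub_le_sup; first by have [] := radii_sup x.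
split; first by rewrite le_min ltW//= ler01/= ge_min lexx orbT.
by apply: subset_trans rG; apply: le_ball; rewrite ge_min lexx.
Qed.

Lemma depth_lipschitz x y : depth x - depth y <= mdist x y.
Proof.
rewrite lerBlDl; apply: ge_sup; first by exists 0.
move=> r [/andP[r0 r1] rG]; have [rd|dr] := leP r (mdist x y).
  by rewrite (le_trans rd)// lerDr depth_ge0.
rewrite -lerBlDr; apply: ub_le_sup; first by have [] := radii_sup y.
split; first by rewrite subr_ge0 ltW//= lerBlDr (le_trans r1)// lerDl mdist_ge0.
move=> z yz; apply: rG; move: yz; rewrite !ballEmdist/= ltrBrDl.
exact: le_lt_trans (metric_triangle _ _ _).
Qed.

End Depth.

Section LowerLimits.
Variables (R : realType) (T : Type) (F : set_system T).
Context {FF : Filter F}.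
Implicit Types (f a : T -> R) (l : R).

(** The inferior limit of [f] is at least [l]: the one-sided form of convergence that
    [cvg_thickening] asks of masses of balls. *)
Definition lower_lim f l := forall h, 0 < h -> \forall t \near F, l - h <= f t.

Lemma cvg_lower_lim f l : f @ F --> l -> lower_lim f l.
Proof.
move=> /cvgrPdist_le fl h /fl; apply: filterS => t.
by rewrite ler_norml => /andP[_]; lra.
Qed.

Lemma lower_lim_le f (f' : T -> R) l : (forall t, f t <= f' t) ->
  lower_lim f l -> lower_lim f' l.
Proof. by move=> ff' fl h /fl; apply: filterS => t /le_trans; apply. Qed.

Lemma lower_limD f f' l l' : lower_lim f l -> lower_lim f' l' ->
  lower_lim (fun t => f t + f' t) (l + l').
Proof.
move=> fl fl' h h0; have h2 : 0 < h / 2 by rewrite divr_gt0.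
by apply: filterS2 (fl _ h2) (fl' _ h2) => t; lra.
Qed.

Lemma lower_limM a f (k : R) l : (forall t, 0 <= a t) -> 0 <= k -> a @ F --> k ->
  lower_lim f l -> lower_lim (fun t => a t * f t) (k * l).
Proof.
move=> a0 k0 ak fl h h0.
have al : (fun t => a t * l) @ F --> k * l by exact: cvgMr_tmp.
have h2 : 0 < h / 2 by rewrite divr_gt0.
have h' : 0 < h / 2 / (k + 1) by rewrite divr_gt0// ltr_wpDl.
have a1 : \forall t \near F, a t <= k + 1.
  by apply: (cvgr_le k) => //; rewrite ltrDl.
apply: filterS3 (cvg_lower_lim al h2) (fl _ h') a1 => t h1 h3 h4.
have : a t * (l - h / 2 / (k + 1)) <= a t * f t by rewrite ler_wpM2l.
have : a t * (h / 2 / (k + 1)) <= h / 2.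
  apply: (@le_trans _ _ ((k + 1) * (h / 2 / (k + 1)))).
    by rewrite ler_wpM2r// ltW.
  by rewrite mulrC divfK// gt_eqF// ltr_wpDl.
rewrite mulrBr; lra.
Qed.

End LowerLimits.

Section Mixture.
Variables (R : realType) (X : choiceType).
Variables (g : X -> R) (a : X).
Implicit Types (p : {fsfun X -> R with 0}) (c d e : R).

(** The combination of [p], of the normalized measure with density [g] with respect to [p], and of
    the Dirac mass at [a], with weights [c], [d], [e]. *)
Definition mixture c d e p : {fsfun X -> R with 0} :=
  [fsfun x in (a |` finsupp p)%fset =>
    c * p x + d / expect g p * (g x * p x) + e * \1_[set a] x | 0].

Lemma mixtureE c d e p x :
  mixture c d e p x = c * p x + d / expect g p * (g x * p x) + e * \1_[set a] x.
Proof.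
rewrite fsfunE; case: ifPn => //; rewrite !inE negb_or => /andP[xa].
rewrite memNfinsupp => /eqP ->; rewrite !mulr0 !add0r indicE memNset ?mulr0//.
exact/eqP.
Qed.

Lemma mixture_supp c d e p :
  (finsupp (mixture c d e p) `<=` a |` finsupp p)%fset.
Proof.
apply/fsubsetP => x; apply: contraLR => xp.
by rewrite memNfinsupp fsfunE (negbTE xp).
Qed.

Lemma expect_mixture c d e p f : expect f (mixture c d e p) =
  c * expect f p + d / expect g p * expect (fun x => g x * f x) p + e * f a.
Proof.
have S1 := fsubsetUr [fset a]%fset (finsupp p).
rewrite (expectE _ (mixture_supp c d e p)) !(expectE (S := (a |` finsupp p)%fset))//.
rewrite !mulr_sumr -big_split/=.
have -> : e * f a = \sum_(x <- (a |` finsupp p)%fset) e * \1_[set a] x * f x.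
  rewrite (big_fsetD1 a)/=; last by rewrite !inE eqxx.
  rewrite indicE mem_set// mulr1 big_seq big1 ?addr0// => x.
  by rewrite !inE => /andP[/eqP xa _]; rewrite indicE memNset// mulr0 mul0r.
rewrite -big_split/=; apply: eq_bigr => x _.
rewrite mixtureE -?(expectE _ S1); ring.
Qed.

End Mixture.

(** * Join coordinates on the simplex *)

Section SimplexTail.
Variable R : realType.

Definition simplex_vertex n : 'rV[R]_n.+1 := \row_i (i == ord0)%:R.

Lemma simplex_vertex_subproof n : simplex_vertex n \in @stdsimplex R n.
Proof.
rewrite inE; split=> [i|]; first by rewrite mxE ler0n.
rewrite (bigD1 ord0)//= mxE eqxx big1 ?addr0// => i i0.
by rewrite mxE (negbTE i0).
Qed.

(* The projection from the vertex [ord0] to the opposite face, with an arbitrary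
   value at that vertex. *)
Definition tail_row n (t : 'rV[R]_n.+2) : 'rV[R]_n.+1 :=
  if t 0 ord0 == 1 then simplex_vertex n
  else \row_i (t 0 (fintype.lift ord0 i) / (1 - t 0 ord0)).

Lemma simplex_tail_subproof n (t : @stdsimplex R n.+1) :
  tail_row (val t) \in @stdsimplex R n.
Proof.
rewrite /tail_row; case: ifPn => [_|t1]; first exact: simplex_vertex_subproof.
have t0 : 0 < 1 - val t 0 ord0 by rewrite subr_gt0 lt_neqAle t1 simplex_le1.
rewrite inE; split=> [i|].
  by rewrite mxE divr_ge0 ?simplex_ge0// ltW.
under eq_bigr do rewrite mxE.
rewrite -mulr_suml (_ : \sum_i _ = 1 - val t 0 ord0) ?divff ?gt_eqF//.
by apply/eqP; rewrite eq_sym subr_eq -(simplex_sum t) big_ord_recl addrC.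
Qed.

Definition simplex_tail n (t : @stdsimplex R n.+1) : @stdsimplex R n :=
  exist (fun x => x \in _) _ (simplex_tail_subproof t).

Lemma simplex_tailE n (t : @stdsimplex R n.+1) i : val t 0 ord0 != 1 ->
  val (simplex_tail t) 0 i = val t 0 (fintype.lift ord0 i) / (1 - val t 0 ord0).
Proof. by move=> t1; rewrite /= /tail_row (negbTE t1) mxE. Qed.

Lemma face_mapE n (k : 'I_n.+2) (t : @stdsimplex R n) i :
  val (face_map k t) 0 (fintype.lift k i) = val t 0 i.
Proof. by rewrite mxE liftK. Qed.

Lemma face_map_ord0 n (t : @stdsimplex R n) : val (face_map ord0 t) 0 ord0 = 0.
Proof. by rewrite mxE unlift_none. Qed.

Lemma face_map_lift0 n (k : 'I_n.+2) (t : @stdsimplex R n.+1) :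
  val (face_map (fintype.lift ord0 k) t) 0 ord0 = val t 0 ord0.
Proof.
rewrite -(face_mapE (fintype.lift ord0 k)); congr (val (face_map _ t) _ _).
exact: val_inj.
Qed.

Lemma simplex_tail_face0 n (t : @stdsimplex R n) :
  simplex_tail (face_map ord0 t) = t.
Proof.
apply: simplexP => i; rewrite simplex_tailE face_map_ord0 1?eq_sym ?oner_eq0//.
by rewrite face_mapE subr0 divr1.
Qed.

Lemma simplex_tail_faceS n (k : 'I_n.+2) (t : @stdsimplex R n.+1) :
  val t 0 ord0 != 1 -> simplex_tail (face_map (fintype.lift ord0 k) t) =
                       face_map k (simplex_tail t).
Proof.
move=> t1; apply: simplexP => i.
rewrite simplex_tailE face_map_lift0//.
case: (unliftP k i) => [j|] ->; rewrite !mxE.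
  rewrite (_ : fintype.lift ord0 (fintype.lift k j) =
    fintype.lift (fintype.lift ord0 k) (fintype.lift ord0 j)); last first.
    by apply: val_inj; rewrite /= /bump; lia.
  by rewrite !liftK/= /tail_row (negbTE t1) mxE.
by rewrite !unlift_none/= mul0r.
Qed.

Lemma simplex_tail_cvg n (t : @stdsimplex R n.+1) : val t 0 ord0 != 1 ->
  simplex_tail u @[u --> t] --> simplex_tail t.
Proof.
move=> t1; apply: cvg_simplex => i; rewrite simplex_tailE//.
have tF : Filter (nbhs t) by exact: nbhs_filter.
have c j : (fun u : @stdsimplex R n.+1 => val u 0 j) @ t --> val t 0 j.
  exact: coord_simplex_continuous.
have u1 : \forall u \near t, val (u : @stdsimplex R n.+1) 0 ord0 != 1.
  exact: (c ord0 _ (open_nbhs_nbhs (conj (@open_neq R 1) t1))).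
apply: (@cvg_trans _ ((fun u : @stdsimplex R n.+1 =>
    val u 0 (fintype.lift ord0 i) / (1 - val u 0 ord0)) @ t)).
  apply: near_eq_cvg; apply: filterS u1 => u u1.
  by rewrite simplex_tailE.
apply: (@cvgM _ _ _ tF); first exact: c.
apply: (@cvgV _ _ _ tF); first by rewrite subr_eq0 eq_sym.
by apply: (@cvgB _ _ _ _ tF); [exact: cvg_cst|exact: c].
Qed.

End SimplexTail.

Section Contraction.
Variables (R : realType) (X : metricType R) (U : set (set X)).

Local Notation VM := (vietoris_thickening U).

Variables (G : set X) (a : X) (A0 : set X).
Hypotheses (Ga : G a) (UA0 : U A0) (GA0 : G `<=` A0).

Local Notation g := (depth G).

Definition start_weight (s : R) : R := Num.max 0 (1 - s * 2).
Definition end_weight (s : R) : R := Num.max 0 (s * 2 - 1).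
Definition mid_weight (s : R) : R := 1 - start_weight s - end_weight s.

(* For [s] in [0, 1/2] the measure is pushed towards [g p], for [s] in [1/2, 1]
   the latter is pushed towards the Dirac mass at [a]; so the support never
   contains both points outside [G] and [a]. *)
Definition contract (s : R) (p : {fsfun X -> R with 0}) :=
  mixture g a (start_weight s) (mid_weight s) (end_weight s) p.

Lemma start_weight_ge0 s : 0 <= start_weight s.
Proof. by rewrite le_max lexx. Qed.

Lemma end_weight_ge0 s : 0 <= end_weight s.
Proof. by rewrite le_max lexx. Qed.

Lemma mid_weight_ge0 s : 0 <= s <= 1 -> 0 <= mid_weight s.
Proof.
rewrite /mid_weight /start_weight /end_weight => s01.
by have [h1|h1] := leP 0 (1 - s * 2); have [h2|h2] := leP 0 (s * 2 - 1); lra.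
Qed.

Lemma start_or_end_weight s : start_weight s = 0 \/ end_weight s = 0.
Proof.
have [s2|s2] := leP (s * 2) 1; [right|left]; apply/max_idPl; lra.
Qed.

Lemma start_weight0 : start_weight 0 = 1.
Proof. by rewrite /start_weight mul0r subr0 max_r. Qed.

Lemma end_weight0 : end_weight 0 = 0.
Proof. by rewrite /end_weight mul0r sub0r max_l// lerN10. Qed.

Lemma mid_weight0 : mid_weight 0 = 0.
Proof. by rewrite /mid_weight start_weight0 end_weight0; lra. Qed.

Lemma start_weight1 : start_weight 1 = 0.
Proof. by apply/max_idPl; lra. Qed.

Lemma end_weight1 : end_weight 1 = 1.
Proof. by rewrite /end_weight max_r; lra. Qed.

Lemma mid_weight1 : mid_weight 1 = 0.
Proof. by rewrite /mid_weight start_weight1 end_weight1; lra. Qed.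

Lemma contract0 p : contract 0 p = p.
Proof.
apply/fsfunP => x; rewrite mixtureE start_weight0 mid_weight0 end_weight0.
by rewrite !mul0r !addr0 mul1r.
Qed.

(** At time 1 only the Dirac mass at [a] remains; this makes the arbitrary value of [simplex_tail]
    at the vertex harmless. *)
Lemma contract1 p q : contract 1 p = contract 1 q.
Proof.
by apply/fsfunP => x; rewrite !mixtureE start_weight1 mid_weight1 !mul0r.
Qed.

Lemma contract_supp s p : (finsupp (contract s p) `<=` a |` finsupp p)%fset.
Proof. exact: mixture_supp. Qed.

Section Bounds.
Variables (s : R) (p : {fsfun X -> R with 0}).
Hypotheses (s01 : 0 <= s <= 1) (pp : fin_prob p) (gp : 0 < expect g p).

Lemma contract_fin_prob : fin_prob (contract s p).
Proof.
split=> [x|].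
  rewrite mixtureE !addr_ge0//; first by rewrite mulr_ge0 ?start_weight_ge0 ?pp.1.
    apply: mulr_ge0; first by rewrite divr_ge0 ?mid_weight_ge0// ltW.
    by rewrite mulr_ge0 ?depth_ge0 ?pp.1.
  by rewrite mulr_ge0 ?end_weight_ge0// indicE.
transitivity (expect (fun=> 1) (contract s p)).
  by apply: eq_bigr => x _; rewrite mulr1.
rewrite expect_mixture expect_cst// !mulr1.
rewrite (@eq_expect _ _ _ g); last by move=> x _; rewrite mulr1.
by rewrite divfK ?gt_eqF// /mid_weight; ring.
Qed.

(** Without the start weight all the mass is in [G], hence in [A0]; without the end weight the
    support does not grow. *)
Lemma contract_supp_in (A : set X) : U A -> [set` finsupp p] `<=` A ->
  exists2 B, U B & [set` finsupp (contract s p)] `<=` B.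
Proof.
move=> UA pA; have [w0|w0] := start_or_end_weight s.
  exists A0 => // x /=; apply: contraPP => A0x; apply/negP; rewrite memNfinsupp mixtureE.
  have nGx : ~ G x by move/GA0.
  rewrite w0 depth_eq0// indicE memNset; last by move=> xa; apply: nGx; rewrite xa.
  by rewrite !(mul0r, mulr0) !addr0.
exists A => // x /=; apply: contraPP => Ax; apply/negP; rewrite memNfinsupp mixtureE w0.
have /eqP -> : p x == 0 by rewrite -memNfinsupp; apply/negP => /pA.
by rewrite !(mul0r, mulr0) !addr0.
Qed.

(** The density part and the Dirac mass live in [G], hence entirely in [A]: replacing part of [p] by
    them can only increase the mass of [A]. *)
Lemma contract_mass (A : set X) (c : R) : G `<=` A -> c < mass A p ->
  c < mass A (contract s p).
Proof.
move=> GA cA; have eg : expect (fun x => g x * \1_A x) p = expect g p.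
  apply: eq_expect => x _; rewrite indicE.
  have [/mem_set ->|Ax] := pselect (A x); first by rewrite mulr1.
  by rewrite memNset// mulr0 depth_eq0// => /GA.
rewrite /mass expect_mixture eg -/(mass A p).
rewrite divfK ?gt_eqF// indicE mem_set ?mulr1; last exact: GA.
apply: (lt_le_trans cA); rewrite /mid_weight.
have : 0 <= (1 - start_weight s) * (1 - mass A p).
  rewrite mulr_ge0// subr_ge0 ?mass_le1//.
  by rewrite ge_max; move: s01; lra.
lra.
Qed.

End Bounds.

Lemma cvg_start_weight s : start_weight u @[u --> s] --> start_weight s.
Proof.
apply: (@max_fun_continuous _ R R (fun=> 0) (fun u => 1 - u * 2)) => u.
  exact: cvg_cst.
by apply: cvgB; [exact: cvg_cst|exact: cvgMr_tmp].
Qed.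

Lemma cvg_end_weight s : end_weight u @[u --> s] --> end_weight s.
Proof.
apply: (@max_fun_continuous _ R R (fun=> 0) (fun u => u * 2 - 1)) => u.
  exact: cvg_cst.
by apply: cvgB; [exact: cvgMr_tmp|exact: cvg_cst].
Qed.

Lemma cvg_mid_weight s : mid_weight u @[u --> s] --> mid_weight s.
Proof.
apply: cvgB; last exact: cvg_end_weight.
by apply: cvgB; [exact: cvg_cst|exact: cvg_start_weight].
Qed.

(** On a smaller ball of radius [r'], the Lipschitz function [g] is at least [g x - r'], and the
    mass of that ball is almost [p x]. Each of the two losses is kept below [h / 2]. *)
Lemma lower_lim_depth_mass (p : VM) x (r : R) : 0 < r ->
  lower_lim (nbhs p) (fun q => expect (fun y => g y * \1_(ball x r) y) (val q))
    (g x * val p x).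
Proof.
move=> r0 h h0.
pose r' := Num.min r (h / 2); pose h' := h / 2 / (g x + 1).
have gx1 : 0 < g x + 1 by rewrite ltr_wpDl// depth_ge0.
have r'0 : 0 < r' by rewrite lt_min r0 divr_gt0.
have h'0 : 0 < h' by rewrite !divr_gt0.
have pF : Filter (nbhs p) by exact: nbhs_filter.
apply: filterS (near_mass_ball p x r'0 h'0) => q hq.
have qq := thickening_fin_prob q.
apply: (@le_trans _ _ ((g x - r') * mass (ball x r') (val q))).
  have m1 := mass_le1 (ball x r') qq.
  have m0 := mass_ge0 (ball x r') qq.
  have e1 : r' * mass (ball x r') (val q) <= h / 2.
    apply: (le_trans (ler_piMr (ltW r'0) m1)).
    by rewrite ge_min lexx orbT.
  have e2 : g x * (val p x - h') <= g x * mass (ball x r') (val q).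
    by rewrite ler_wpM2l ?depth_ge0// ltW.
  have e3 : g x * h' <= h / 2.
    apply: (@le_trans _ _ ((g x + 1) * h')); last by rewrite mulrC divfK// gt_eqF.
    by rewrite ler_wpM2r ?lerDl// ltW.
  move: e1 e2; rewrite mulrBr mulrBl; lra.
rewrite /mass /expect mulr_sumr; apply: ler_sum => y _.
rewrite mulrCA ler_wpM2l ?thickening_ge0// !indicE.
have [yr'|yr'] := pselect (ball x r' y); last first.
  by rewrite (memNset yr') mulr0 mulr_ge0// depth_ge0.
have yr : ball x r y by apply: le_ball yr'; rewrite ge_min lexx.
rewrite (mem_set yr) (mem_set yr') !mulr1 lerBlDl -lerBlDr (le_trans (depth_lipschitz _ _ _))//.
by move: yr'; rewrite ballEmdist/= => /ltW.
Qed.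

End Contraction.

(** * The cone operator on singular simplices given by the contraction *)

Section ContractionCone.
Variables (R : realType) (X : metricType R) (U : set (set X)).
Hypothesis Ubounded : uniformly_bounded U.

Local Notation VM := (vietoris_thickening U).
Local Notation sing := (singular_simplex R VM).

Variables (G : set X) (a : X) (A0 : set X).
Hypotheses (Ga : G a) (UA0 : U A0) (GA0 : G `<=` A0).

Local Notation g := (depth G).

Definition meets_in n : set (sing n) := [set s | forall t, 0 < expect g (val (s t))].

Section ConeFunction.
Variables (n : nat) (s : sing n).
Hypothesis gs : meets_in s.

Let contract_subproof (t : @stdsimplex R n.+1) :
  contract G a (val t 0 ord0) (val (s (simplex_tail t))) \in
  [set p : {fsfun X -> R with 0} | fin_prob p /\
     exists2 A, U A & [set` finsupp p] `<=` A].
Proof.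
have pp := thickening_fin_prob (s (simplex_tail t)).
rewrite inE; split.
  by apply: contract_fin_prob => //; rewrite simplex_ge0 simplex_le1.
have [A UA pA] := thickening_supp (s (simplex_tail t)).
exact: (contract_supp_in Ga UA0 GA0 _ UA pA).
Qed.

Definition contract_cone (t : @stdsimplex R n.+1) : VM :=
  exist (fun p => p \in _) _ (contract_subproof t).

Lemma contract_cone_continuous : continuous contract_cone.
Proof.
move=> t; have tF : Filter (nbhs t) by exact: nbhs_filter.
apply: cvg_thickening => // x r h xt r0.
suff : lower_lim (nbhs t) (fun u => mass (ball x r) (val (contract_cone u)))
    (val (contract_cone t) x) by apply.
pose c j (u : @stdsimplex R n.+1) := val u 0 (j : 'I_n.+2).
have cc : c ord0 u @[u --> t] --> c ord0 t by exact: coord_simplex_continuous.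
pose p (u : @stdsimplex R n.+1) := val (s (simplex_tail u)).
pose m1 u := start_weight (c ord0 u) * mass (ball x r) (p u).
pose m2 u := mid_weight (c ord0 u) / expect g (p u) *
  expect (fun y => g y * \1_(ball x r) y) (p u).
pose m3 u := end_weight (c ord0 u) * \1_(ball x r) a.
have mE : (fun u => mass (ball x r) (val (contract_cone u))) =
    (fun u => m1 u + m2 u + m3 u).
  by apply/funext => u; rewrite /mass /= expect_mixture.
have pu u : fin_prob (p u) by exact: thickening_fin_prob.
have m1_ge0 u : 0 <= m1 u by rewrite mulr_ge0 ?start_weight_ge0 ?mass_ge0.
have mid0 u : 0 <= mid_weight (c ord0 u) / expect g (p u).
  apply: divr_ge0; last exact/ltW/gs.
  by apply: mid_weight_ge0; rewrite simplex_ge0 simplex_le1.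
have m2_ge0 u : 0 <= m2 u.
  rewrite mulr_ge0//; apply: expect_ge0 => // y _.
  by rewrite mulr_ge0 ?depth_ge0// indicE.
have l3 : lower_lim (nbhs t) m3 (end_weight (c ord0 t) * \1_[set a] x).
  apply: lower_limM; [|exact: end_weight_ge0| |].
  - by move=> u; exact: end_weight_ge0.
  - exact: cvg_comp cc (@cvg_end_weight _ _).
  - move=> e e0; apply: filterE => u; rewrite !indicE.
    have [xa|xa] := pselect ([set a] x).
      rewrite (mem_set xa) mem_set ?gerBl ?ltW// -xa; exact: ballxx.
    by rewrite (memNset xa) sub0r (@le_trans _ _ 0)// oppr_le0 ltW.
rewrite mE /= mixtureE -/(c ord0 t) -/(p t).
(* At the vertex [simplex_tail] need not be continuous. There the limit is the Dirac mass, so the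
   third summand alone gives the lower bound, the other two being nonnegative. *)
have [t1|t1] := eqVneq (c ord0 t) 1.
  rewrite t1 start_weight1 mid_weight1 !mul0r !add0r -t1.
  by apply: lower_lim_le l3 => u; rewrite lerDr addr_ge0.
have scvg : s (simplex_tail u) @[u --> t] --> s (simplex_tail t).
  by apply: cvg_comp (simplex_tail_cvg t1) _; exact: cts_fun.
have Ecvg : expect g (p u) @[u --> t] --> expect g (p t).
  apply: (@cvg_comp _ _ _ (fun u => s (simplex_tail u))
    (fun q : VM => expect g (val q)) _ _ _ scvg).
  by apply: cvg_expect; exact: depth_lipschitz.
apply: lower_limD => //; apply: lower_limD.
  apply: lower_limM; [|exact: start_weight_ge0| |].
  - by move=> u; exact: start_weight_ge0.
  - exact: cvg_comp cc (@cvg_start_weight _ _).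
  - move=> e e0; have sF := @nbhs_filter VM (s (simplex_tail t)).
    exact: scvg _ (filterS (fun q => @ltW _ _ _ _)
      (near_mass_ball (s (simplex_tail t)) x r0 e0)).
apply: lower_limM => //.
  apply: (@cvgM _ _ _ tF); first exact: cvg_comp cc (@cvg_mid_weight _ _).
  by apply: (@cvgV _ _ _ tF) => //; rewrite gt_eqF//; exact: gs.
move=> e e0.
exact: scvg _ (@lower_lim_depth_mass _ _ _ G (s (simplex_tail t)) x r r0 e e0).
Qed.

End ConeFunction.

(** [chain_map] requires a total function, so a constant simplex serves as default where the
    contraction is undefined. *)
Lemma cone_simplex_exists n (s : sing n) : exists k : sing n.+1,
  meets_in s -> forall t, val (k t) =
    contract G a (val t 0 ord0) (val (s (simplex_tail t))).
Proof.
have [gs|ngs] := pselect (meets_in s).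
  by exists (mkcts (@contract_cone_continuous n s gs)).
have cc : continuous (fun _ : @stdsimplex R n.+1 =>
    s (exist (fun x => x \in _) _ (simplex_vertex_subproof R n))).
  exact: cst_continuous.
by exists (mkcts cc) => /ngs.
Qed.

Definition cone_simplex n (s : sing n) : sing n.+1 :=
  projT1 (cid (cone_simplex_exists s)).

Lemma cone_simplexE n (s : sing n) t : meets_in s ->
  val (cone_simplex s t) =
    contract G a (val t 0 ord0) (val (s (simplex_tail t))).
Proof. by move=> gs; rewrite /cone_simplex; case: cid => k /= ->. Qed.

Lemma face0_cone_simplex n (s : sing n) : meets_in s ->
  singular_face ord0 (cone_simplex s) = s.
Proof.
move=> gs; apply: singularP => t; apply: val_inj.
rewrite [LHS](cone_simplexE (face_map ord0 t) gs).
by rewrite face_map_ord0 contract0 simplex_tail_face0.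
Qed.

Lemma faceS_cone_simplex n (s : sing n.+1) k : meets_in s ->
  singular_face (fintype.lift ord0 k) (cone_simplex s) =
  cone_simplex (singular_face k s).
Proof.
move=> gs; apply: singularP => t; apply: val_inj.
rewrite [LHS](cone_simplexE (face_map (fintype.lift ord0 k) t) gs).
rewrite cone_simplexE; last by move=> u; exact: gs.
rewrite face_map_lift0.
have [->|t1] := eqVneq (val t 0 ord0) 1; first exact: contract1.
by rewrite simplex_tail_faceS.
Qed.

End ContractionCone.

(** * Acyclicity of intersections modulo finitely supported chains *)

Section RelativeAcyclicity.
Variables (R : realType) (X : metricType R) (U : set (set X)).
Hypotheses (Ucover : open_cover U) (Ubounded : uniformly_bounded U).

Local Notation VM := (vietoris_thickening U).
Local Notation sing := (singular_simplex R VM).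
Local Notation face := (@singular_face R VM).

(* The singular simplices of the thickening which are continuous for the topology
   of the complex. *)
Definition finitely_supported n : set (sing n) :=
  [set s | exists S : {fset X}, forall t, (finsupp (val (s t)) `<=` S)%fset].

Lemma finitely_supported0 (s : sing 0) : finitely_supported s.
Proof.
have t0 : @stdsimplex R 0 :=
  exist (fun x => x \in _) _ (simplex_vertex_subproof R 0).
exists (finsupp (val (s t0))) => t; suff -> : t = t0 by [].
apply: simplexP => i; rewrite (ord1 i).
by have := simplex_sum t; have := simplex_sum t0; rewrite !big_ord1 => -> ->.
Qed.

Lemma finitely_supported_affine m n (s : sing m) (M : @stochastic R m n) :
  finitely_supported s -> finitely_supported (sing_affine s M).
Proof. by move=> [S hS]; exists S => t; exact: hS. Qed.

Lemma finitely_supported_face n k (s : sing n.+1) :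
  finitely_supported s -> finitely_supported (singular_face k s).
Proof. by move=> [S hS]; exists S => t; exact: hS. Qed.

Variable N : nat.

(** Each of at most [N] sets misses less than 1/(N+1) of the mass, so together they miss less than
    1. *)
Let bound : R := 1 - N.+1%:R^-1.

Definition heavy (A : set X) n : set (sing n) :=
  [set s | U A /\ forall t, bound < mass A (val (s t))].

Lemma heavy_face A n (k : 'I_n.+2) (s : sing n.+1) :
  heavy A s -> heavy A (singular_face k s).
Proof. by move=> [UA hs]; split=> // t; exact: hs. Qed.

Definition inter (L : seq (set X)) : set X := [set x | forall A, A \in L -> A x].

Lemma open_inter L : (forall A, A \in L -> open A) -> open (inter L).
Proof.
move=> oL; rewrite openE => x Lx; apply: filter_seq => A AL.
by apply: open_nbhs_nbhs; split; [exact: oL|exact: Lx].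
Qed.

(** The union bound for complements: a point outside the intersection is missed by at least one
    member of [L]. *)
Lemma mass_inter L (p : {fsfun X -> R with 0}) : fin_prob p ->
  1 - mass (inter L) p <= \sum_(A <- L) (1 - mass A p).
Proof.
move=> pp.
have massC A : 1 - mass A p = expect (fun x => 1 - \1_A x) p.
  by rewrite expectB expect_cst.
rewrite massC (eq_bigr (fun A => expect (fun x => 1 - \1_A x) p))//.
rewrite -expect_sum; apply: ler_expect => // x _.
have s0 (L' : seq (set X)) : 0 <= \sum_(A <- L') (1 - \1_A x : R).
  by apply: sumr_ge0 => A _; rewrite subr_ge0 indicE lern1 leq_b1.
have [xL|xL] := pselect (inter L x); first by rewrite indicE mem_set// subrr.
have /existsNP[A /not_implyP[AL Ax]] := xL.
rewrite indicE (memNset xL) subr0 (perm_big _ (perm_to_rem AL)) big_cons.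
by rewrite indicE (memNset Ax) subr0 lerDl.
Qed.

Lemma mass_inter_gt0 L p : fin_prob p -> (size L <= N)%N ->
  (forall A, A \in L -> bound < mass A p) -> 0 < mass (inter L) p.
Proof.
move=> pp LN hL; have := mass_inter L pp.
suff : \sum_(A <- L) (1 - mass A p) < 1 by lra.
apply: (@le_lt_trans _ _ (\sum_(A <- L) N.+1%:R^-1)).
  rewrite big_seq [leRHS]big_seq; apply: ler_sum => A /hL.
  by rewrite /bound ltrBlDr -ltrBlDl => /ltW.
rewrite big_const_seq count_predT iter_addr_0 -[_^-1 *+ _]mulr_natl.
by rewrite ltr_pdivrMr ?ltr0n// mul1r ltr_nat ltnS.
Qed.

Lemma expect_depth_gt0 (G : set X) (p : {fsfun X -> R with 0}) : open G ->
  fin_prob p -> 0 < mass G p -> 0 < expect (depth G) p.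
Proof.
move=> oG pp /mass_gt0[x xp Gx]; rewrite /expect (big_fsetD1 x)//=.
apply: ltr_pwDl.
  rewrite mulr_gt0 ?depth_gt0// lt_neqAle pp.1 andbT eq_sym.
  by rewrite -mem_finsupp.
by rewrite sumr_ge0// => y _; rewrite mulr_ge0 ?depth_ge0 ?pp.1.
Qed.

Lemma heavy_acyclic A L n (c : {freeg (sing n) / int}) : (size L < N)%N ->
  supported (@all_in _ _ heavy (A :: L) n) c ->
  rel_cycle face finitely_supported c ->
  rel_boundary face finitely_supported (@all_in _ _ heavy (A :: L) n.+1) c.
Proof.
case: n c => [|n] c LN hc cc.
  by apply: rel_boundary_F => s _; exact: finitely_supported0.
(* If there is no such simplex, [c] has empty domain. Otherwise [s0] yields the apex [a] in [G] and
   the membership of all the sets in [U]. *)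
have [[s0 hs0]|ne] := pselect (exists s : sing n.+1, all_in heavy (A :: L) s);
  last first.
  by apply: rel_boundary_F => s /hc hs; case: ne; exists s.
pose G := inter (A :: L).
have UL B : B \in A :: L -> U B by move=> /hs0[].
have UA : U A by apply: UL; rewrite inE eqxx.
have oG : open G by apply: open_inter => B /UL/Ucover.1.
have GA : G `<=` A by move=> x; apply; rewrite inE eqxx.
have Gs m (s : sing m) t : all_in heavy (A :: L) s -> 0 < mass G (val (s t)).
  move=> hs; apply: mass_inter_gt0 => //; first exact: thickening_fin_prob.
  by move=> B /hs[_].
have [a _ Ga] : exists2 a, a \in finsupp (val (s0
    (exist (fun x => x \in _) _ (simplex_vertex_subproof R n.+1)))) & G a.
  by apply: mass_gt0; exact: Gs.
have gs m (s : sing m) : all_in heavy (A :: L) s -> meets_in G s.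
  move=> hs t; apply: expect_depth_gt0 => //; first exact: thickening_fin_prob.
  exact: Gs.
pose k m : sing m -> sing m.+1 := cone_simplex Ubounded Ga UA GA (n := m).
exists (chain_map (@k n.+1) c).
  apply: chain_map_supported hc => s hs B BL; split=> [|t]; first exact: UL.
  rewrite cone_simplexE; last exact: gs.
  apply: contract_mass => //.
  - by rewrite simplex_ge0 simplex_le1.
  - exact: thickening_fin_prob.
  - exact: gs.
  - by move=> x; apply.
  - by have [_] := hs B BL.
rewrite (@bd_cone _ _ _ k (@all_in _ _ heavy (A :: L) n.+1))//.
(* What remains is the cone over the boundary of [c], which is finitely supported; coning adds only
   [a] to the supports. *)
- rewrite subKr; have hbc : supported (@all_in _ _ heavy (A :: L) n) (bd face c).
    by apply: bd_supported hc => s i hs B /hs; exact: heavy_face.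
  apply: chain_map_supported (supportedI cc hbc) => s [[S hS] hs].
  exists (a |` S)%fset => t; rewrite cone_simplexE; last exact: gs.
  apply: fsubset_trans (contract_supp _ _ _ _) _.
  by apply: fsetUS; exact: hS.
- by move=> s hs; apply: face0_cone_simplex; exact: gs.
- by move=> s i hs; apply: faceS_cone_simplex; exact: gs.
Qed.

End RelativeAcyclicity.

Lemma thickening_relative_acyclicity (R : realType) (X : metricType R)
    (U : set (set X)) n
    (c : {freeg (singular_simplex R (vietoris_thickening U) n) / int}) :
  open_cover U -> uniformly_bounded U ->
  rel_cycle (@singular_face R _) (@finitely_supported R X U) c ->
  rel_boundary (@singular_face R _) (@finitely_supported R X U) setT c.
Proof.
move=> Ucover Ubounded cc; pose bound : R := 1 - n.+1%:R^-1.
pose O (A : U) : set (vietoris_thickening U) :=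
  [set p | bound < mass (val A) (val p)].
have cov p : exists2 A, open (O A) & O A p.
  have [A UA pA] := thickening_supp p.
  exists (exist (fun x => x \in U) A (mem_set UA)).
    by apply: open_mass; exact: Ucover.1.
  rewrite /O/= mass_eq1 ?ltrBlDr ?ltrDl ?invr_gt0 ?ltr0n//.
  exact: thickening_fin_prob.
have [c' [bc' cc' sc']] :=
  rel_boundary_small (@finitely_supported_affine R X U) cov cc.
(* One set is chosen per simplex of [c'], so that a finite list of sets suffices even for an
   infinite cover. *)
have /choice[f hf] : forall s, exists A, s \in dom c' -> heavy n A s.
  move=> s; have [/sc'[A hA]|_] := boolP (s \in dom c'); last by exists setT.
  exists (val A) => _; split; first by apply/set_mem; exact: valP.
  by move=> t; apply: hA; exists t.
have [|e he Fe] := @rel_boundary_some_in _ (@singular_face R _)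
  (@singular_face_face R _) (@finitely_supported R X U)
  (@finitely_supported0 R X U) (fun m k s => @finitely_supported_face R X U m k s)
  _ (@heavy R X U n) (@heavy_face R X U n) n
  (@heavy_acyclic R X U Ucover Ubounded n) n [seq f s | s <- dom c'] [::] c'
  (leqnn n) _ cc'.
  move=> s sc; right; exists (f s); first exact: map_f.
  by move=> A; rewrite inE => /eqP ->; exact: hf.
rewrite -(subrK c' c); apply: rel_boundaryD => //.
by exists e.
Qed.

(** * Singular simplices of the complex *)

Section RealizationSimplices.
Variables (R : realType) (V : choiceType) (K : set {fset V}).

Local Notation Real := (realization R K).

Lemma realization_fin_prob (p : Real) : fin_prob (val p).
Proof. by case: p => p /= /set_mem[]. Qed.

Lemma realization_supp (p : Real) : K (finsupp (val p)).
Proof. by case: p => p /= /set_mem[]. Qed.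

(** The weak topology is tested on one closed simplex at a time, where the expectation of any [f] is
    a finite linear combination of coordinates. *)
Lemma open_realization_expect (f : V -> R) (c : R) :
  open [set p : Real | c < expect f (val p)].
Proof.
move=> s Ks; exists [set v : {ptws s -> R} | c < \sum_(x : s) v x * f (val x)].
  apply: (@open_comp _ _ (fun v : {ptws s -> R} => \sum_(x : s) v x * f (val x))
    [set y | c < y]); last exact: open_gt.
  move=> v _; have vF : Filter (nbhs v) by exact: nbhs_filter.
  apply: cvg_sumr => x; apply: cvgMr_tmp.
  exact: (@proj_continuous s (fun=> R) x).
by move=> p ps; rewrite /= (expectE _ ps) big_seq_fsetE.
Qed.

(* A compact set meets only finitely many open simplices: otherwise some weighted
   sum of barycentric coordinates would be unbounded on it. *)
Lemma singular_realization_supp n (s : singular_simplex R Real n) :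
  exists S : {fset V}, forall t, (finsupp (val (s t)) `<=` S)%fset.
Proof.
pose E := [set x | exists t, x \in finsupp (val (s t))].
have [/finite_fsetP[S ES]|/infiniteP/card_leP[f]] := pselect (finite_set E).
  exists S => t; apply/fsubsetP => x xt.
  suff : [set` S] x by [].
  by rewrite -ES; exists t.
exfalso.
have /choice[tt htt] : forall x, exists t, E x -> x \in finsupp (val (s t)).
  move=> x; have [[t xt]|nE] := pselect (E x); first by exists t.
  by exists (exist (fun x => x \in _) _ (simplex_vertex_subproof R n)).
pose u (k : nat) : V := val (f (exist (fun x => x \in setT) k (mem_set Logic.I))).
have uE k : E (u k) by apply: set_mem; exact: valP.
have u_inj : injective u.
  move=> k l /val_inj/(@inj _ _ _ f _ _ (mem_set Logic.I) (mem_set Logic.I)).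
  by case.
pose w x := val (s (tt x)) x.
have w_gt0 k : 0 < w (u k).
  rewrite lt_neqAle (realization_fin_prob _).1 andbT eq_sym -mem_finsupp.
  exact: htt.
(* The weight at [u k] is scaled so that this vertex alone contributes [k] to the expectation at the
   parameter [tt (u k)]; compactness bounds that expectation by some [b]. *)
have /choice[c hc] : forall x, exists c : R,
    0 <= c /\ forall k, x = u k -> c = k%:R / w (u k).
  move=> x; have [[k xk]|nk] := pselect (exists k, x = u k).
    exists (k%:R / w (u k)); split; first by rewrite divr_ge0// ltW.
    by move=> l; rewrite xk => /u_inj ->.
  by exists 0; split=> // k xk; case: nk; exists k.
have /compact_near_coveringP/(_ R (+oo%R : set_system R)
    (fun b t => expect c (val (s t)) < b) _) : compact [set: @stdsimplex R n].
  exact: simplex_compact.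
have covered t : [set: @stdsimplex R n] t -> \forall t' \near t & b \near +oo%R,
    expect c (val (s t')) < b.
  move=> _; exists ([set t' : @stdsimplex R n |
      expect c (val (s t')) < expect c (val (s t)) + 1],
    [set b | expect c (val (s t)) + 1 < b]).
    split=> /=; last by apply: nbhs_pinfty_gt; exact: num_real.
    have oW := @open_realization_expect (fun x => - c x)
      (- (expect c (val (s t)) + 1)).
    have eN p : expect (fun x => - c x) p = - expect c p.
      by rewrite /expect -sumrN; apply: eq_bigr => x _; rewrite mulrN.
    have : nbhs (s t) [set p : Real | - (expect c (val (s t)) + 1) <
        expect (fun x => - c x) (val p)].
      by apply: open_nbhs_nbhs; split=> //=; rewrite eN ltrN2 ltrDl.
    have tF : Filter (nbhs t) by exact: nbhs_filter.
    move=> /(@cts_fun _ _ s t); apply: (@filterS _ _ tF) => t' /=.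
    by rewrite eN ltrN2.
  by move=> [t' b] /= [h1 h2]; exact: lt_trans h1 h2.
move=> /(_ covered)/filter_ex[b hb].
pose k := (Num.truncn `|b|).+1.
have kb : b < k%:R by rewrite (le_lt_trans (ler_norm _))// truncnS_gt.
have := hb (tt (u k)) Logic.I; apply/negP.
rewrite -leNgt (le_trans (ltW kb))//.
have uk := htt _ (uE k).
rewrite /expect (big_fsetD1 (u k))//= ((hc (u k)).2 k)// mulrC divfK; last first.
  by rewrite gt_eqF// w_gt0.
rewrite lerDl sumr_ge0// => x _.
by rewrite mulr_ge0 ?(realization_fin_prob _).1// (hc x).1.
Qed.

End RealizationSimplices.

Lemma cvg_ptws (T : Type) (F : set_system T) (I : Type) (Y : topologicalType)
    (f : T -> {ptws I -> Y}) (l : {ptws I -> Y}) : Filter F ->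
  (forall i, (fun t => f t i) @ F --> l i) -> f @ F --> l.
Proof.
move=> FF fl; apply/cvg_sup => i B [_ [[W oW <-] /= Wl] sB].
have := fl i W (open_nbhs_nbhs (conj oW Wl)); apply: (@filterS _ _ FF) => t Wt.
exact: sB.
Qed.

(** * Passing between simplices of the complex and of the thickening *)

Section Comparison.
Variables (R : realType) (X : metricType R) (U : set (set X)).
Hypothesis Ubounded : uniformly_bounded U.

Local Notation VM := (vietoris_thickening U).
Local Notation Real := (realization R (vietoris_complex U)).

Lemma realization_thickening_subproof (p : Real) :
  val p \in [set p : {fsfun X -> R with 0} | fin_prob p /\
     exists2 A, U A & [set` finsupp p] `<=` A].
Proof.
by rewrite inE; split; [exact: realization_fin_prob|case: (realization_supp p)].
Qed.

Definition to_thickening (p : Real) : VM :=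
  exist (fun p => p \in _) _ (realization_thickening_subproof p).

Lemma thickening_realization_subproof (p : VM) :
  val p \in [set p : {fsfun X -> R with 0} | fin_prob p /\
     vietoris_complex U (finsupp p)].
Proof.
have pp := thickening_fin_prob p.
rewrite inE; split=> //; split; last exact: thickening_supp.
by have [x xp] := fin_prob_neq0 pp; apply/fset0Pn; exists x.
Qed.

Definition to_realization (p : VM) : Real :=
  exist (fun p => p \in _) _ (thickening_realization_subproof p).

Lemma to_thickening_continuous : continuous to_thickening.
Proof.
move=> p; have pF : Filter (nbhs p) by exact: nbhs_filter.
apply: cvg_thickening => // x r h xp r0 h0.
have oW := @open_realization_expect R X (vietoris_complex U) \1_[set x]
  (val p x - h).
have : nbhs p [set q : Real | val p x - h < mass [set x] (val q)].
  apply: open_nbhs_nbhs; split=> //=.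
  by rewrite [mass _ _]expect_indic1 gtrBl.
apply: filterS => q /= /ltW /le_trans; apply.
apply: ler_mass; first exact: realization_fin_prob.
by move=> _ _ ->; exact: ballxx.
Qed.

Definition sing_to_thickening n (s : singular_simplex R Real n) :
  singular_simplex R VM n := mkcts to_thickening_continuous \o s.

Lemma sing_to_thickening_inj n : injective (@sing_to_thickening n).
Proof.
move=> s s' ss'; apply: singularP => t.
apply: val_inj.
exact: (congr1 (fun f : singular_simplex R VM n => val (f t)) ss').
Qed.

Lemma sing_to_thickening_supported n (s : singular_simplex R Real n) :
  finitely_supported (sing_to_thickening s).
Proof. exact: singular_realization_supp. Qed.

Lemma lower_lim_sum (T : Type) (F : set_system T) (I : Type) (r : seq I)
    (f : I -> T -> R) (l : I -> R) : Filter F ->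
  (forall i, lower_lim F (f i) (l i)) ->
  lower_lim F (fun t => \sum_(i <- r) f i t) (\sum_(i <- r) l i).
Proof.
move=> FF fl; elim: r => [|i r IHr].
  move=> h h0; apply: filterE => t; rewrite !big_nil.
  by rewrite lerBlDr lerDl ltW.
rewrite big_cons.
rewrite (_ : (fun _ => _) = fun t => f i t + \sum_(i <- r) f i t).
  exact: lower_limD.
by apply/funext => t; rewrite big_cons.
Qed.

(** A small ball around [x] contains no other point of the finite set [S], so its mass is at most
    the coordinate at [x]. *)
Lemma lower_lim_coord (S : {fset X}) (T : Type) (F : set_system T)
    (f : T -> VM) (p : VM) x : Filter F ->
  (forall t, (finsupp (val (f t)) `<=` S)%fset) -> f @ F --> p ->
  lower_lim F (fun t => val (f t) x) (val p x).
Proof.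
move=> FF fS fp h h0.
have [r r0 hr] : exists2 r : R, 0 < r & forall y, y \in (S : seq X) ->
    y != x -> r <= mdist x y.
  apply: seq_pos_bound => [y e e' he ee yx|y yS].
    exact: le_trans (he yx).
  have [->|yx] := eqVneq y x; first by exists 1.
  by exists (mdist x y); rewrite ?mdist_gt0// eq_sym.
have := fp _ (near_mass_ball p x r0 h0).
apply: (@filterS _ _ FF) => t /= /ltW /le_trans; apply.
rewrite -[leRHS]expect_indic1; apply: ler_mass; first exact: thickening_fin_prob.
move=> y yt; rewrite ballEmdist/= => xy; apply: contrapT => /eqP yx.
have := hr y (fsubsetP (fS t) _ yt) yx.
by rewrite leNgt xy.
Qed.

(** Coordinates sum to 1, so lower bounds on all the other ones give the upper bound on the one at
    [x]. *)
Lemma cvg_coord (S : {fset X}) (T : Type) (F : set_system T)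
    (f : T -> VM) (p : VM) x : Filter F ->
  (forall t, (finsupp (val (f t)) `<=` S)%fset) ->
  (finsupp (val p) `<=` S)%fset -> f @ F --> p ->
  (fun t => val (f t) x) @ F --> val p x.
Proof.
move=> FF fS pS fp.
have fSx t : (finsupp (val (f t)) `<=` x |` S)%fset.
  exact: fsubset_trans (fS t) (fsubsetUr _ _).
have pSx : (finsupp (val p) `<=` x |` S)%fset.
  exact: fsubset_trans pS (fsubsetUr _ _).
have sum1 (q : VM) : (finsupp (val q) `<=` x |` S)%fset ->
    1 = val q x + \sum_(y <- ((x |` S) `\ x)%fset) val q y.
  move=> qS; rewrite -(expect_cst 1 (thickening_fin_prob q)) (expectE _ qS).
  rewrite (big_fsetD1 x)/= ?mulr1; last by rewrite !inE eqxx.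
  by congr (_ + _); apply: eq_bigr => y _; rewrite mulr1.
have lo y := lower_lim_coord y FF fSx fp.
have hi := lower_lim_sum (((x |` S) `\ x)%fset : seq X) FF lo.
apply/cvgrPdist_le => e e0; apply: filterS2 (lo x e e0) (hi e e0) => t h1 h2.
have e1 := sum1 _ (fSx t); have e2 := sum1 _ pSx.
by rewrite ler_norml; apply/andP; split; lra.
Qed.

(** Only finitely many supports [F], all subsets of [S], can occur near [t]; each is treated
    separately, since weak openness speaks of one closed simplex at a time. *)
Lemma to_realization_continuous n (s : singular_simplex R VM n) :
  finitely_supported s -> continuous (to_realization \o s).
Proof.
move=> [S hS] t A; have tF : Filter (nbhs t) by exact: nbhs_filter.
have st : s u @[u --> t] --> s t by exact: cts_fun.
rewrite nbhsE => -[W [oW Wt] WA].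
suff nW : \forall u \near t, forall F : {fset X}, F \in fpowerset S ->
    finsupp (val (s u)) = F -> W (to_realization (s u)).
  apply: filterS nW => u nW; apply: WA; apply: (nW _ _ erefl).
  by rewrite fpowersetE.
apply: filter_seq => F _.
have [KF|nKF] := pselect (vietoris_complex U F); last first.
  apply: filterE => u uF; case: nKF; rewrite -uF.
  exact: realization_supp (to_realization (s u)).
(* If a vertex of the support at [t] is missing from [F], its coordinate stays nonzero nearby, so
   the support [F] does not occur there. *)
have [tFs|] := boolP (finsupp (val (s t)) `<=` F)%fset; last first.
  move=> /fsubsetPn[x xt xF].
  have := @cvg_coord S _ _ (fun u => s u) (s t) x tF hS (hS t) st.
  move=> /cvgr_neq0; rewrite -mem_finsupp => /(_ xt).
  apply: filterS => u ux uF.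
  by move: xF; rewrite -uF mem_finsupp ux.
have [P oP hP] := oW F KF.
have Ot : P (barycentric (to_realization (s t))) by apply/hP.
have bt : (fun u => barycentric (to_realization (s u)) : {ptws F -> R}) @ t -->
    (barycentric (to_realization (s t)) : {ptws F -> R}).
  apply: cvg_ptws => x.
  exact: (@cvg_coord S _ _ (fun u => s u) (s t) (val x) tF hS (hS t) st).
have := bt _ (open_nbhs_nbhs (conj oP Ot)).
apply: (@filterS _ _ tF) => u Ou uF.
by apply/(hP (to_realization (s u))); rewrite //= uF.
Qed.

Lemma sing_to_thickening_surj n (s : singular_simplex R VM n) :
  finitely_supported s -> exists s', sing_to_thickening s' = s.
Proof.
move=> fs; exists (mkcts (to_realization_continuous fs)).
by apply: singularP => t; apply: val_inj.
Qed.

End Comparison.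

(** * Comparison of the homology groups *)

Section HomologyClass.
Local Open Scope quotient_scope.
Variables (R : realType) (T : topologicalType) (n : nat).

Local Notation Hn := {ideal_quot (@singular_boundaries R T n)}.

Definition homology_class (z : singular_cycle R T n) : homology R T n :=
  \pi_Hn z.

Lemma homology_classP z w : homology_class z = homology_class w <->
  z - w \in @singular_boundaries R T n.
Proof.
rewrite (Quotient.idealrBE (@singular_boundaries R T n)); split=> [h|/eqP//].
by apply/eqP; exact: h.
Qed.

Lemma homology_class_onto (x : homology R T n) : exists z, homology_class z = x.
Proof. by exists (repr (x : Hn)); exact: reprK. Qed.

Lemma homology_classB : {morph homology_class : z w / z - w}.
Proof. exact: (raddfB (\pi_Hn : singular_cycle R T n -> Hn)). Qed.

End HomologyClass.

Section HomologyIsomorphism.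
Variables (R : realType) (T T' : topologicalType).

Local Notation sing := (singular_simplex R T).
Local Notation sing' := (singular_simplex R T').
Local Notation face' := (@singular_face R T').

Variables (J : forall n, sing n -> sing' n) (F : forall n, set (sing' n)).
Hypothesis J_inj : forall n, injective (@J n).
Hypothesis J_face : forall n k (s : sing n.+1),
  singular_face k (J s) = J (singular_face k s).
Hypothesis FJ : forall n (s : sing n), F (J s).
Hypothesis JF : forall n (s : sing' n), F s -> exists s', J s' = s.
Hypothesis F_acyclic : forall n (c : {freeg (sing' n) / int}),
  rel_cycle face' F c -> rel_boundary face' F setT c.

Local Notation Jc := (fun n => chain_map (@J n)).

Lemma chain_map_boundary n (c : singular_chain R T n.+1) :
  singular_boundary (chain_map (@J n.+1) c : singular_chain R T' n.+1) =
  chain_map (@J n) (singular_boundary c).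
Proof.
apply: (@bd_chain_map _ _ face' (@singular_face R T) J) => k s.
exact: J_face.
Qed.

Lemma chain_map_F n c : supported (@F n) (chain_map (@J n) c).
Proof. by apply: (@chain_map_supported _ _ _ setT) => // s _; exact: FJ. Qed.

Lemma chain_map_inj n : injective (chain_map (@J n)).
Proof.
apply: raddf_inj => c c0; apply/eqP; apply/negPn/negP => cn0.
have : exists s, s \in dom c.
  apply: contrapT => nd; move/negP: cn0; apply; apply/eqP.
  by apply: supported_set0 => s sc; apply: nd; exists s.
move=> [s]; rewrite mem_dom => /eqP; apply.
suff <- : coeff (J s) (chain_map (@J n) c) = coeff s c by rewrite c0 raddf0.
apply: (@eq_freeg _ _ (coeff (J s) \o chain_map (@J n)) (coeff s)) => x /=.
by rewrite chain_mapU !coeffU (inj_eq (@J_inj n)).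
Qed.

Lemma chain_map_onto n c : supported (@F n) c ->
  exists c', chain_map (@J n) c' = c.
Proof.
move: c; apply: supported_ind => [|k s c Fs _ [c' <-]].
  by exists 0; rewrite raddf0.
have [s' <-] := JF Fs.
exists (k *: << s' >> + c'); rewrite raddfD/= additiveZint/= chain_mapU.
by rewrite -[in LHS](intz k) scaler_int freegU_mulz intz.
Qed.

Lemma chain_map_cycle n (z : singular_chain R T n) :
  (chain_map (@J n) z \in @singular_cycles R T' n) = (z \in @singular_cycles R T n).
Proof.
case: n z => [//|n] z; rewrite !unfold_in/= chain_map_boundary.
apply/eqP/eqP => [h|->]; last by rewrite raddf0.
by apply: chain_map_inj; rewrite h raddf0.
Qed.

Lemma rel_cycle_of_cycle n (z : singular_chain R T' n) :
  z \in @singular_cycles R T' n -> rel_cycle face' F z.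
Proof.
case: n z => [//|n] z; rewrite unfold_in => /eqP h.
by rewrite /rel_cycle [bd _ _]h; exact: supported0.
Qed.

Lemma boundary_cycle n (c : singular_chain R T' n.+1) :
  singular_boundary c \in @singular_cycles R T' n.
Proof.
case: n c => [//|n] c; rewrite unfold_in; apply/eqP.
exact: (bd_bd (@singular_face_face R T')).
Qed.

Definition cycle_map n (z : singular_cycle R T n) : singular_cycle R T' n :=
  SingularCycle (eq_ind_r is_true (valP z) (chain_map_cycle (val z))).

Lemma cycle_mapB n : {morph @cycle_map n : x y / x - y}.
Proof.
move=> x y; apply: val_inj; rewrite /= raddfB/= -raddfB.
by congr chain_map.
Qed.

(** Injectivity on homology. A chain [c] bounding the image of [z] is a relative cycle; subtracting
    the boundary of a suitable [e] moves it into [F], hence into the image of [J], without changing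
    its boundary. *)
Lemma cycle_map_boundary n (z : singular_cycle R T n) :
  (cycle_map z \in @singular_boundaries R T' n) =
  (z \in @singular_boundaries R T n).
Proof.
rewrite !unfold_in; apply/asboolP/asboolP => -[c hc]; last first.
  by exists (chain_map (@J n.+1) c); rewrite chain_map_boundary hc.
have cF : rel_cycle face' F c by rewrite /rel_cycle [bd _ _]hc; exact: chain_map_F.
have [e _ he] := F_acyclic cF; have [c' hc'] := chain_map_onto he.
exists c'; apply: (@chain_map_inj n); rewrite -chain_map_boundary hc'.
rewrite raddfB/= [X in _ - X](bd_bd (@singular_face_face R T')) subr0.
exact: hc.
Qed.

(** Surjectivity on homology: a cycle is a relative cycle, hence differs by a boundary from a chain
    in [F], which comes from a cycle of the source. *)
Lemma cycle_map_onto n (w : singular_cycle R T' n) :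
  exists z, w - cycle_map z \in @singular_boundaries R T' n.
Proof.
have [e _ he] := F_acyclic (rel_cycle_of_cycle (valP w)).
have [z hz] := chain_map_onto he.
have zc : z \in @singular_cycles R T n.
  rewrite -chain_map_cycle hz rpredB ?boundary_cycle//; exact: valP.
exists (SingularCycle zc); rewrite unfold_in; apply/asboolP; exists e.
rewrite raddfB/= hz opprB addrCA subrr addr0.
by [].
Qed.

(** [J] induces a map [g] in the opposite direction, defined through representatives; [f] is its
    inverse. *)
Lemma homology_isomorphism n :
  exists f : {additive homology R T' n -> homology R T n}, bijective f.
Proof.
have /choice[r rE] := @homology_class_onto R T n.
pose g x := homology_class (cycle_map (r x)).
have gE z : g (homology_class z) = homology_class (cycle_map z).
  apply/homology_classP; rewrite -cycle_mapB cycle_map_boundary.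
  by apply/homology_classP.
have gB : {morph g : x y / x - y}.
  move=> x y; rewrite -[x]rE -[y]rE -homology_classB !gE cycle_mapB.
  exact: homology_classB.
have g_inj : injective g.
  move=> x y; rewrite -[x]rE -[y]rE !gE => /homology_classP.
  by rewrite -cycle_mapB cycle_map_boundary => /homology_classP.
have g_onto y : exists x, g x = y.
  have [w <-] := homology_class_onto y; have [z hz] := cycle_map_onto w.
  by exists (homology_class z); rewrite gE; apply/esym/homology_classP.
pose f y := projT1 (cid (g_onto y)).
have gf y : g (f y) = y by rewrite /f; case: cid.
have fg x : f (g x) = x by apply: g_inj; rewrite gf.
have fB : additive f by move=> x y; apply: g_inj; rewrite gB !gf.
pose h : {additive homology R T' n -> homology R T n} :=
  HB.pack f (GRing.isAdditive.Build _ _ f fB).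
by exists h, g.
Qed.

End HomologyIsomorphism.

Theorem mainTheorem2 (R : realType) (X : metricType R) (U : set (set X))
    (Ucover : open_cover U) (Ubounded : uniformly_bounded U) (j : nat) :
  exists f : {additive homology R (vietoris_thickening U) j ->
                       homology R (realization R (vietoris_complex U)) j},
    bijective f.
Proof.
apply: (@homology_isomorphism _ _ _ (@sing_to_thickening R X U Ubounded)
  (@finitely_supported R X U)).
- exact: sing_to_thickening_inj.
- by move=> n k s; apply: singularP.
- exact: sing_to_thickening_supported.
- exact: sing_to_thickening_surj.
- by move=> n c; exact: thickening_relative_acyclicity.
Qed.
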